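(* Consider the VCG-Learn algorithm described in the context, run with $\mathtt{est}\in\{\mathrm{ETC},\mathrm{OPT}\}$ and $\mathtt{price}\in\{\mathrm{AGE},\mathrm{SEL}\}$. Let $\pi$ be any non-truthful strategy for agent $i$, and fix the strategies adopted by the other agents. Let $U^\pi_{i,T}$ and $U_{i,T}$ be the sum of agent $i$'s utilities over the first $T$ rounds when she follows $\pi$ and when she is truthful, respectively. The following statements hold for any $\mathtt{price}\in\{\mathrm{AGE},\mathrm{SEL}\}$ and all $T>2K$. 1. Let $\mathtt{est}=\mathrm{ETC}$. If agent $i$ participates by bids then, regardless of the behaviour of the others, $U^\pi_{i,T}-U_{i,T}\le 0$ almost surely; i.e. the algorithm is truthful. If agent $i$ participates by rewards then, regardless of the behaviour of the others, $$\mathbb E[U^\pi_{i,T}-U_{i,T}]\ \le\ 10\,\sigma\sqrt{\log(|\mathcal S|T)}\;K^{1/3}T^{2/3}+4\ \in\ \widetilde{O}(K^{1/3}T^{2/3}).$$ 2. Let $\mathtt{est}=\mathrm{OPT}$ and assume all agents other than $i$ adopt stationary strategies. Then, for any (stationary or non-stationary) strategy $\pi$ of agent $i$, $$\mathbb E[U^\pi_{i,T}-U_{i,T}]\ \le\ 10\,\sigma(6n+2)\sqrt{\log(|\mathcal S|T)}\;K^{1/3}T^{2/3}+12n\ \in\ \widetilde O(nK^{1/3}T^{2/3}).$$ In particular, for an agent participating by rewards the algorithm is asymptotically truthful when $\mathtt{est}=\mathrm{ETC}$ and asymptotically Nash incentive-compatible when $\mathtt{est}=\mathrm{OPT}$.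
   Context: Problem. There are $n$ agents and a seller. There is a finite set of outcomes $\Omega$, a finite set of allocations $\mathcal S$, and maps $\phi_i:\Omega\to\mathcal S$ ($\phi_i(\omega)$ is agent $i$'s allocation under $\omega$). Agent $i$ has a value function $v_i:\mathcal S\to[0,1]$; write $v_i(\omega)=v_i(\phi_i(\omega))$. The seller has a known value function $v_0:\Omega\to\mathbb R$. In each round $t=1,2,\dots$ the mechanism chooses an outcome $\omega_t$ and prices $p_{i,t}$; agent $i$ then realises a reward $X_{i,t}$ drawn from a $\sigma$-sub-Gaussian distribution with mean $v_i(\phi_i(\omega_t))$ depending only on $i$ and the allocation $\phi_i(\omega_t)$, independently across agents and rounds. One may take independent potential rewards $X_{i,t}(s)$ for all $i,t,s$, with $X_{i,t}=X_{i,t}(\phi_i(\omega_t))$; runs under different strategies of agent $i$ are compared on the same realisation of these. Participation. Each agent participates either by bids (she submits once, before round 1, a bid function $b_i:\mathcal S\to[0,1]$) or by rewards (at the end of each round she reports a number $Y_{i,t}$ to the mechanism). Being truthful means $b_i=v_i$, respectively $Y_{i,t}=X_{i,t}$ for all $t$. A strategy for an agent participating by bids is the bid she submits; for an agent participating by rewards it is a (possibly randomised) map from her past information $\{(\phi_i(\omega_\ell),p_{i,\ell},X_{i,\ell},Y_{i,\ell})\}_{\ell<t}$ and current $(\phi_i(\omega_t),p_{i,t},X_{i,t})$ to the report $Y_{i,t}$. A strategy is stationary if the agent participates by bids or if, participating by rewards, when assigned allocation $s$ she reports a sample from some fixed distribution depending on $s$; otherwise it is non-stationary. The round-$t$ utility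 of agent $i$ is $u_{i,t}=v_i(\omega_t)-p_{i,t}$, and her sum of utilities is $\sum_{t=1}^Tu_{i,t}$. Algorithm (VCG-Learn). Let $K$ be the minimum number of rounds needed to assign every allocation in $\mathcal S$ to every agent at least once. The algorithm proceeds in brackets $q=1,2,\dots$. Bracket $q$ starts with an explore phase of $K$ rounds, following a fixed non-adaptive sequence of outcomes that assigns every allocation to every agent at least once; prices are $0$ and reported rewards are collected. It is followed by $\lfloor\frac56Kq^{1/2}\rfloor$ further rounds. On such a round $t$ of bracket $q$: let $D_t$ be the set of explore-phase rounds before $t$ if $\mathtt{est}=\mathrm{ETC}$, and $D_t=\{1,\dots,t-1\}$ if $\mathtt{est}=\mathrm{OPT}$ (if an agent receives the same allocation several times in one explore phase, only one of those reports, chosen arbitrarily, is used). For an agent participating by rewards let $N_{i,t}(s)$ be the number of used rounds $\ell\in D_t$ with $\phi_i(\omega_\ell)=s$, let $\bar v_{i,t}(s)$ be the average of the corresponding reports $Y_{i,\ell}$ clipped to $[0,1]$, and let $\hat v_{i,t}(s),\check v_{i,t}(s)=\bar v_{i,t}(s)\pm\sigma\sqrt{\frac{5\log(t-qK+1)+2\log|\mathcal S|}{N_{i,t}(s)}}$ (upper, lower). For an agent participating by bids, $\bar v_{i,t}=\hat v_{i,t}=\check v_{i,t}=b_i$. The outcome is $\omega_t\in\mathrm{argmax}_{\omega}\big(v_0(\omega)+\sum_{i=1}^n\hat v_{i,t}(\phi_i(\omega))\big)$. Set $(f_{i,t},g_{i,t})=(\check v_{i,t},\hat v_{i,t})$ if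 $\mathtt{price}=\mathrm{AGE}$ and $(f_{i,t},g_{i,t})=(\hat v_{i,t},\check v_{i,t})$ if $\mathtt{price}=\mathrm{SEL}$. With $F_{-i,t}(\omega)=v_0(\omega)+\sum_{j\ne i}f_{j,t}(\phi_j(\omega))$ and $G_{-i,t}(\omega)=v_0(\omega)+\sum_{j\neq i}g_{j,t}(\phi_j(\omega))$, agent $i$ is charged $p_{i,t}=\max_{\omega}F_{-i,t}(\omega)-G_{-i,t}(\omega_t)$. Definitions. A mechanism is truthful if $U^\pi_{i,T}\le U_{i,T}$ a.s. for all $\pi,T$, regardless of the behaviour of other agents; asymptotically truthful if $\mathbb E[U^\pi_{i,T}-U_{i,T}]\in o(T)$ for all $\pi$, regardless of the behaviour of other agents; asymptotically Nash incentive-compatible if the same $o(T)$ bound holds when the other agents are truthful. $\widetilde O$ hides factors polylogarithmic in $T$ and $|\mathcal S|$ and constants depending on $\sigma$.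
   Formalization: For ETC, the other agents' explore-phase reports are assumed almost surely equal in the two compared runs (false if they react to past prices); for OPT, stationary agents' fixed report distributions are assumed σ-sub-Gaussian with any mean (false for arbitrary distributions). *)

(* Defs.v *)
From HB Require Import structures.
From mathcomp Require Import all_boot all_order all_algebra.
From mathcomp Require Import all_classical all_reals all_analysis.

Set Implicit Arguments.
Unset Strict Implicit.
Unset Printing Implicit Defensive.

Import Order.TTheory GRing.Theory Num.Theory.
Import numFieldNormedType.Exports.

Local Open Scope classical_set_scope.
Local Open Scope ring_scope.

Section Probability.
Context {R : realType}.

(* mutual independence of an arbitrary family of real random variables *)
Definition independent_family d (W : measurableType d) (P : probability W R)
    (I : choiceType) (Z : I -> W -> R) : Prop :=
  forall (J : seq I) (A : I -> set R), uniq J -> (forall k, measurable (A k)) ->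
    P [set w | forall k, k \in J -> A k (Z k w)] =
    (\prod_(k <- J) P (Z k @^-1` A k))%E.

Definition sub_gaussian (sigma m : R)
    (D : probability (measurableTypeR R) R) : Prop :=
  ('E_D[(fun x => x)] = m%:E)%E /\
  forall l : R,
    ('E_D[(fun x => expR (l * (x - m))%R)]
       <= (expR (sigma ^+ 2 * l ^+ 2 / 2))%:E)%E.

Definition sampled_from d (W : measurableType d) (P : probability W R)
    (Z : W -> R) (D : probability (measurableTypeR R) R) : Prop :=
  forall A : set R, measurable A -> P (Z @^-1` A) = D A.

(* An upper bound in o(T): `a <= f` for some f in o(T).  A two-sided little-o
   would wrongly exclude strategies that lose a linear amount. *)
Definition sublinear (a : nat -> \bar R) : Prop :=
  exists2 f : nat -> R, f =o_\oo (fun T : nat => T%:R : R) &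
    forall T, (a T <= (f T)%:E)%E.

(* `B \in Otilde(r)` for functions of the number n of agents, the number s of
   allocations, K and the horizon T: the constant c and the degree p of the
   polylogarithmic factor may not depend on n, s, K, T. *)
Definition soft_O (B r : nat -> nat -> nat -> nat -> R) : Prop :=
  exists (c : R) (p : nat), forall n s K T : nat,
    (0 < n)%N -> (0 < s)%N -> (0 < K)%N -> (2 * K < T)%N ->
    B n s K T <= c * ln (s%:R * T%:R) ^+ p * r n s K T.

End Probability.

Inductive estimation := ETC | OPT.
Inductive pricing := AGE | SEL.

Section VCGLearn.
Context {R : realType} {n : nat} {Omega S : finType}.

Record problem := Problem {
  alloc : 'I_n -> Omega -> S ;
  value : 'I_n -> S -> R ;
  seller_value : Omega -> R ;
  value_range : forall i s, 0 <= value i s <= 1 }.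

Definition covers (pb : problem) (e : nat -> Omega) (K : nat) : Prop :=
  forall i s, exists2 k, (k < K)%N & alloc pb i (e k) = s.

(* The choices that the algorithm leaves open.  `explore_seq k`, k < K, is the
   outcome of the (k+1)-th round of every explore phase; `used_at q i s` is the
   position in the explore phase of bracket q of the one report of agent i for
   allocation s that is used. It is fixed in advance, i.e. not data-dependent.
   `tie_break t` selects an element of the argmax on round t. *)
Record implementation (pb : problem) := Implementation {
  phase_length : nat ;
  explore_seq : nat -> Omega ;
  explore_covers : covers pb explore_seq phase_length ;
  phase_length_min : forall e K, covers pb e K -> (phase_length <= K)%N ;
  used_at : nat -> 'I_n -> S -> nat ;
  used_at_lt : forall q i s, (used_at q i s < phase_length)%N ;
  used_atP : forall q i s, alloc pb i (explore_seq (used_at q i s)) = s ;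
  tie_break : nat -> {set Omega} -> Omega ;
  tie_breakP : forall t (A : {set Omega}), A != finset.set0 ->
    tie_break t A \in A }.

(* What an agent observes on a past round:
   (allocation, (price, reward, submitted report)). *)
Definition observation : Type := (S * (R * R * R))%type.

(* `Reports f`: the report is f past s (p, x, z), where s, p and x are the
   current allocation, price and reward, and z is a private random seed. *)
Inductive strategy :=
  | Bids of (S -> R)
  | Reports of (seq observation -> S -> R * R * R -> R).

Definition by_bids (st : strategy) : bool :=
  if st is Bids _ then true else false.

Definition valid_strategy (st : strategy) : Prop :=
  match st with
  | Bids b => forall s, 0 <= b s <= 1
  | Reports f => forall (t : nat) (a : t.-tuple S) (s : S),
      measurable_fun [set: t.-tuple (measurableTypeR R * measurableTypeR R *
                                     measurableTypeR R) *
                           (measurableTypeR R * measurableTypeR R *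
                            measurableTypeR R)]
        (fun u => f (zip a u.1) s u.2 : measurableTypeR R)
  end.

Definition truthful_version (pb : problem) (i : 'I_n) (st : strategy) :=
  match st with
  | Bids _ => Bids (value pb i)
  | Reports _ => Reports (fun _ _ u => u.1.2)
  end.

Definition deviate (i : 'I_n) (pi : strategy) (others : 'I_n -> strategy) :=
  fun j => if j == i then pi else others j.

Section Run.
Variables (pb : problem) (im : implementation pb) (sigma : R).
Variables (est : estimation) (pr : pricing) (st : 'I_n -> strategy).
Local Notation K := (phase_length im).

(* Rounds and brackets are numbered from 1. *)
Definition exploit_length (q : nat) : nat :=
  Num.truncn (5 / 6 * K%:R * Num.sqrt q%:R : R).

(* number of rounds that precede bracket q *)
Definition bracket_start (q : nat) : nat :=
  (\sum_(1 <= r < q) (K + exploit_length r))%N.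

(* The bracket of round t is the number of q >= 1 with bracket_start q < t;
   since K > 0 all of them are at most t. *)
Definition bracket (t : nat) : nat :=
  count (fun q => bracket_start q < t)%N (iota 1 t).

(* position of round t inside its bracket, numbered from 0 *)
Definition position (t : nat) : nat := (t - bracket_start (bracket t)).-1.

Definition exploring (t : nat) : bool := (position t < K)%N.

Record round_record := RoundRecord {
  rd_index : nat ;
  rd_outcome : Omega ;
  rd_price : 'I_n -> R ;
  rd_reward : 'I_n -> R ;
  rd_report : 'I_n -> R }.

Section Round.
(* h lists the rounds before round t *)
Variables (t : nat) (h : seq round_record).

Definition used (i : 'I_n) (s : S) (r : round_record) : bool :=
  (alloc pb i (rd_outcome r) == s) &&
  (if exploring (rd_index r)
   then used_at im (bracket (rd_index r)) i s == position (rd_index r)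
   else if est is OPT then true else false).

Definition sample_count (i : 'I_n) (s : S) : nat := count (used i s) h.

(* it is the average that is clipped, not the individual reports *)
Definition clipped_mean (i : 'I_n) (s : S) : R :=
  Num.max 0 (Num.min 1
    ((\sum_(r <- h | used i s r) rd_report r i) / (sample_count i s)%:R)).

Definition width (i : 'I_n) (s : S) : R :=
  sigma * Num.sqrt
    ((5 * ln (t%:R - (bracket t * K)%:R + 1) + 2 * ln #|S|%:R)
       / (sample_count i s)%:R).

Definition upper (i : 'I_n) (s : S) : R :=
  match st i with
  | Bids b => b s
  | Reports _ => clipped_mean i s + width i s
  end.

Definition lower (i : 'I_n) (s : S) : R :=
  match st i with
  | Bids b => b s
  | Reports _ => clipped_mean i s - width i s
  end.

Definition welfare (o : Omega) : R :=
  seller_value pb o + \sum_(j < n) upper j (alloc pb j o).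

Definition exploit_outcome : Omega :=
  tie_break im t [set o | [forall o', welfare o' <= welfare o]]%SET.

Definition f_est := if pr is AGE then lower else upper.
Definition g_est := if pr is AGE then upper else lower.

Definition F_others (i : 'I_n) (o : Omega) : R :=
  seller_value pb o + \sum_(j < n | j != i) f_est j (alloc pb j o).
Definition G_others (i : 'I_n) (o : Omega) : R :=
  seller_value pb o + \sum_(j < n | j != i) g_est j (alloc pb j o).

(* explore_seq im 0 only provides the element needed to start the maximum *)
Definition exploit_price (i : 'I_n) : R :=
  \big[Num.max/F_others i (explore_seq im 0)]_(o : Omega) F_others i o
    - G_others i exploit_outcome.

Definition outcome_at : Omega :=
  if exploring t then explore_seq im (position t) else exploit_outcome.

Definition price_at (i : 'I_n) : R :=
  if exploring t then 0 else exploit_price i.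

Definition past_of (i : 'I_n) : seq observation :=
  [seq (alloc pb i (rd_outcome r),
        (rd_price r i, rd_reward r i, rd_report r i)) | r <- h].

(* x: potential rewards, z: seeds of round t.  An agent who participates by
   bids makes no report; the 0 recorded for her is never read. *)
Definition play_round (x : 'I_n -> S -> R) (z : 'I_n -> R) : round_record :=
  let rew i := x i (alloc pb i outcome_at) in
  RoundRecord t outcome_at price_at rew
    (fun i => match st i with
              | Bids _ => 0
              | Reports f => f (past_of i) (alloc pb i outcome_at)
                               (price_at i, rew i, z i)
              end).

End Round.

(* rounds 1, ..., T *)
Fixpoint history (x : 'I_n -> nat -> S -> R) (z : 'I_n -> nat -> R) (T : nat)
    : seq round_record :=
  if T is T'.+1 then
    rcons (history x z T')
      (play_round T (history x z T') (fun i => x i T) (fun i => z i T))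
  else [::].

Definition total_utility (i : 'I_n) (h : seq round_record) : R :=
  \sum_(r <- h) (value pb i (alloc pb i (rd_outcome r)) - rd_price r i).

Definition explore_reports (j : 'I_n) (h : seq round_record) : seq R :=
  [seq rd_report r j | r <- h & exploring (rd_index r)].

End Run.

Section Random.
Context d (W : measurableType d) (P : probability W R).
Variables (X : 'I_n -> nat -> S -> {RV P >-> R}).
Variables (xi : 'I_n -> nat -> {RV P >-> R}).

(* The potential rewards X i t s and the seeds xi i t, all together. *)
Definition primitive (k : ('I_n * nat * S) + ('I_n * nat)) : W -> R :=
  match k with
  | inl (i, t, s) => X i t s
  | inr (i, t) => xi i t
  end.

(* Whenever agent j is assigned s she reports a sample from Q s, whatever
   happened before.  The sample may be computed from the current reward and
   the current seed, so that truthful reporting is stationary.  Q s has to be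
   sigma-sub-Gaussian, as sigma is the scale that the algorithm uses in the
   confidence widths of all reports; its mean is arbitrary. *)
Definition stationary (sigma : R) (j : 'I_n) (st : strategy) : Prop :=
  match st with
  | Bids _ => True
  | Reports f =>
      exists (Q : S -> probability (measurableTypeR R) R)
             (g : S -> R -> R -> R),
        [/\ forall past s p x z, f past s (p, x, z) = g s x z,
            forall t s, sampled_from P (fun w => g s (X j t s w) (xi j t w)) (Q s) &
            forall s, exists m, sub_gaussian sigma m (Q s)]
  end.

Variables (pb : problem) (im : implementation pb) (sigma : R).
Variables (est : estimation) (pr : pricing) (i : 'I_n).

Definition run (st : 'I_n -> strategy) (T : nat) (w : W) :=
  history im sigma est pr st (fun j t s => X j t s w) (fun j t => xi j t w) T.

(* U^pi_{i,T} - U_{i,T}, on the same realisation of rewards and seeds *)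
Definition gain (pi : strategy) (others : 'I_n -> strategy) (T : nat) (w : W)
    : R :=
  total_utility pb i (run (deviate i pi others) T w) -
  total_utility pb i
    (run (deviate i (truthful_version pb i pi) others) T w).

(* The others behave in the same way in the two compared runs: what they
   report in explore phases does not react to agent i's switch from the
   truthful strategy to pi. Their reports in all other rounds, and any
   other dependence of their reports on their information, are unrestricted. *)
Definition same_behaviour (pi : strategy) (others : 'I_n -> strategy) (T : nat)
    : Prop :=
  {ae P, forall w, forall j, j != i ->
    explore_reports im j (run (deviate i pi others) T w) =
    explore_reports im j
      (run (deviate i (truthful_version pb i pi) others) T w)}.

Definition asymptotically_truthful_by_rewards : Prop :=
  forall pi others, valid_strategy pi -> ~~ by_bids pi ->
    (forall j, j != i -> valid_strategy (others j)) ->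
    (forall T, same_behaviour pi others T) ->
    sublinear (fun T => 'E_P[gain pi others T])%E.

Definition asymptotically_NIC_by_rewards : Prop :=
  forall pi others, valid_strategy pi -> ~~ by_bids pi ->
    (forall j, j != i -> others j = truthful_version pb j (others j)) ->
    sublinear (fun T => 'E_P[gain pi others T])%E.

End Random.
End VCGLearn.

Section Bounds.
Context {R : realType}.

Definition rate (n s K T : nat) : R :=
  K%:R `^ (1 / 3) * T%:R `^ (2 / 3).

Definition bound_ETC (sigma : R) (n s K T : nat) : R :=
  10 * sigma * Num.sqrt (ln (s%:R * T%:R)) * rate n s K T + 4.

Definition bound_OPT (sigma : R) (n s K T : nat) : R :=
  10 * sigma * (6 * n%:R + 2) * Num.sqrt (ln (s%:R * T%:R)) * rate n s K T
    + 12 * n%:R.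

End Bounds.

(* Main.v *)
Require Import Defs.
From HB Require Import structures.
From mathcomp Require Import all_boot all_order all_algebra.
From mathcomp Require Import all_classical all_reals all_analysis.
From mathcomp Require Import measurable_realfun.
From mathcomp Require Import zify ring lra.

Set Implicit Arguments.
Unset Strict Implicit.
Unset Printing Implicit Defensive.

Import Order.TTheory GRing.Theory Num.Theory.
Import numFieldNormedType.Exports.

Local Open Scope classical_set_scope.
Local Open Scope ring_scope.

(** On an exploit round all widths of bracket [q] are at most
[radius t = sigma * sqrt (L / q)], [L = 5 ln (e + 1) + 2 ln |S|], where [e]
counts the exploit rounds up to [t]; since bracket [q] has about
[5/6 K sqrt q] exploit rounds, the radii add up to
[O(sigma * sqrt (ln (|S| T)) * K^(1/3) T^(2/3))].

ETC: every agent has exactly [q] used reports for each allocation, so all widths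
of a round agree, AGE and SEL differ by a constant in the price, and VCG
optimality bounds the gain of the round by the estimation error of the truthful
agent at two allocations.

OPT: if on both runs all estimates are within twice their width of the values
that they converge to, both rounds are VCG rounds up to [12 n] radii.
Otherwise, comparing the price with the outcome actually chosen bounds the gain
by 2 plus the same number of radii.  The tolerance of twice the width makes the
union bound over the random number of samples summable in [e], and the constant
of the theorem leaves room for it.

The allocations are chosen adaptively, so the deviation of an empirical mean is
controlled by the supermartingale
[exp (l * sum (Y - m) - l^2 sigma^2 / 2 * #samples)]: the outcome of round [t]
is measurable for the past, hence independent of the reward and the seed of
round [t].  For [sigma = 0] the reports equal their mean almost surely. *)

(** * Brackets and rounds *)

(** Bad events never appear as events. Each is dominated pointwise by a nonnegative sum of
    exponentials with a known integral, and the gain of a round is at most a deterministic term plus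
    a multiple of such a sum; indicators of bad events need not be shown measurable. The Chernoff
    parameter suited to [k] samples depends on [k], whereas the supermartingale bound holds for a
    deterministic parameter. Under OPT the number of samples is random but takes one of [e]
    consecutive values, and the bound is summed over them; under ETC it equals the bracket and no
    sum arises. Under OPT the two runs drift apart after a single different report, so they are not
    compared with each other: both are compared with the same limits, which exist because the others
    are stationary. The constant 10 comes from [2 * sqrt 5 * (5/6) * (193/10)^(1/3) < 10]: the
    factor 2 of the ETC gain, the 5 in front of the logarithm, the bracket length, and the bound on
    the number of brackets. *)

Lemma iota1S T : iota 1 T.+1 = iota 1 T ++ [:: T.+1].
Proof. by rewrite -[T.+1 in LHS]addn1 iotaD add1n. Qed.

Section Rounds.
Context {R : realType} {n : nat} {Omega S : finType}.
Variables (pb : @problem R n Omega S) (im : implementation pb) (i0 : 'I_n).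
Local Notation K := (phase_length im).

Lemma phase_length_gt0 : (0 < K)%N.
Proof. exact: leq_ltn_trans (used_at_lt im 0 i0 (alloc pb i0 (explore_seq im 0))). Qed.

Lemma card_alloc_gt0 : (0 < #|S|)%N.
Proof. by apply/card_gt0P; exists (alloc pb i0 (explore_seq im 0)). Qed.

Lemma bracket_start1 : bracket_start im 1 = 0%N.
Proof. by rewrite /bracket_start big_geq. Qed.

Lemma bracket_startS q : (0 < q)%N ->
  bracket_start im q.+1 = (bracket_start im q + (K + exploit_length im q))%N.
Proof. by move=> q0; rewrite /bracket_start big_nat_recr. Qed.

Lemma bracket_start_lt q r : (0 < q)%N -> (q < r)%N ->
  (bracket_start im q < bracket_start im r)%N.
Proof.
have K0 := phase_length_gt0.
move=> q0; elim: r => // r IH; rewrite ltnS leq_eqVlt => /orP[/eqP <-|qr].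
  by rewrite bracket_startS //; lia.
by have := IH qr; rewrite bracket_startS; lia.
Qed.

(** No bracket is empty, so a bracket that starts before round [t] has index at most [t], and the
    range [iota 1 t] in [bracket] misses none. *)
Lemma ltn_bracket_start q : (0 < q)%N -> (q <= bracket_start im q + 1)%N.
Proof.
case: q => // q _; elim: q => [|q IH]; first by rewrite bracket_start1.
by have := @bracket_start_lt q.+1 q.+2 isT (leqnn _); lia.
Qed.

Lemma bracket_uniq t q : (0 < q)%N ->
  (bracket_start im q < t <= bracket_start im q.+1)%N -> bracket im t = q.
Proof.
move=> q0 /andP[lo hi].
have qt : (q <= t)%N by have := ltn_bracket_start q0; lia.
(* Since [bracket_start] is strictly increasing, the brackets counted are exactly 1, ..., [q]. *)
have -> : bracket im t = count (fun r => (r <= q)%N) (iota 1 t).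
  apply: eq_in_count => r; rewrite mem_iota => /andP[r1 _].
  apply/idP/idP => [rt|].
    rewrite leqNgt; apply/negP => qr; move: qr; rewrite leq_eqVlt => /orP[/eqP qr|qr].
      by move: rt hi; rewrite -qr; lia.
    by have := @bracket_start_lt q.+1 r isT qr; lia.
  rewrite leq_eqVlt => /orP[/eqP -> //|rq].
  by have := bracket_start_lt r1 rq; lia.
rewrite -(subnKC qt) iotaD count_cat.
have /eqP -> : count (fun r => (r <= q)%N) (iota 1 q) == q.
  rewrite -[X in _ == X](size_iota 1 q) -all_count; apply/allP => r.
  by rewrite mem_iota; lia.
have /eqP -> : count (fun r => (r <= q)%N) (iota (1 + q) (t - q)) == 0%N.
  rewrite -leqn0 leqNgt -has_count; apply/hasPn => r.
  by rewrite mem_iota; lia.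
by rewrite addn0.
Qed.

Lemma round_state t : (0 < t)%N -> [/\ (0 < bracket im t)%N,
  t = (bracket_start im (bracket im t) + (position im t).+1)%N &
  (position im t < K + exploit_length im (bracket im t))%N].
Proof.
have K0 := phase_length_gt0.
suff Hex : (0 < t)%N -> exists q, (0 < q)%N /\
    (bracket_start im q < t <= bracket_start im q.+1)%N.
  move=> t0; have [q [q0 Hq]] := Hex t0; have bE := bracket_uniq q0 Hq.
  rewrite /position bE; split => //; first by lia.
  by move: Hq; rewrite bracket_startS //; lia.
case: t => // t; elim: t => [|t IH] _.
  by exists 1%N; split => //; rewrite (@bracket_startS 1) // bracket_start1; lia.
have [q [q0 /andP[lo hi]]] := IH isT.
have [tq|tq] := leqP t.+2 (bracket_start im q.+1); first by exists q; split => //; lia.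
exists q.+1; split => //; apply/andP; split => //.
by have := @bracket_start_lt q.+1 q.+2 isT (leqnn _); lia.
Qed.

Lemma bracket1 : bracket im 1 = 1%N.
Proof.
apply: bracket_uniq => //; rewrite (@bracket_startS 1) // bracket_start1.
by have := phase_length_gt0; lia.
Qed.

Lemma position1 : position im 1 = 0%N.
Proof. by rewrite /position bracket1 bracket_start1. Qed.

(** Either the bracket continues or [t] is its last round; this alternative drives the inductions
    over rounds. *)
Lemma round_next t : (0 < t)%N ->
  [/\ bracket im t.+1 = bracket im t, position im t.+1 = (position im t).+1 &
      ((position im t).+1 < K + exploit_length im (bracket im t))%N] \/
  [/\ bracket im t.+1 = (bracket im t).+1, position im t.+1 = 0%N &
      (position im t).+1 = (K + exploit_length im (bracket im t))%N].
Proof.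
move=> t0; have [b0 tE pt] := round_state t0; have K0 := phase_length_gt0.
have [lt|ge] := ltnP (position im t).+1 (K + exploit_length im (bracket im t)).
- left; have bE : bracket im t.+1 = bracket im t.
    by apply: bracket_uniq => //; rewrite bracket_startS //; lia.
  by split => //; rewrite /position bE; lia.
- right; have bE : bracket im t.+1 = (bracket im t).+1.
    apply: bracket_uniq => //.
    by rewrite [bracket_start im _.+2]bracket_startS // bracket_startS //; lia.
  by split => //; [rewrite /position bE bracket_startS //|]; lia.
Qed.

Definition exploit_count (T : nat) : nat :=
  count (fun t => ~~ exploring im t) (iota 1 T).

Lemma exploit_countS T :
  exploit_count T.+1 = (exploit_count T + ~~ exploring im T.+1)%N.
Proof. by rewrite /exploit_count iota1S count_cat /= addn0. Qed.

(** Splits the rounds into exploit rounds, the explore phases of finished brackets, and the explore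
    rounds of the current bracket. *)
Lemma round_decomp t : (0 < t)%N ->
  t = (exploit_count t + (bracket im t).-1 * K + minn (position im t).+1 K)%N.
Proof.
have K0 := phase_length_gt0.
case: t => // t _; elim: t => [|t IH].
  rewrite bracket1 position1 exploit_countS /exploring position1.
  by rewrite K0 /exploit_count /=; lia.
have [b0 _ _] := @round_state t.+1 isT.
rewrite exploit_countS /exploring.
have [[-> -> _]|[-> -> E]] := @round_next t.+1 isT; first by rewrite {1}IH; lia.
rewrite {1}IH K0 /=; move: (exploit_count t.+1) => a.
case: (bracket im t.+1) b0 E => // b _ E; rewrite /= mulSn.
by lia.
Qed.

(** Identifies [t - q * K], which enters the logarithm of the width, as the number of exploit rounds
    up to and including [t]. *)
Lemma exploit_round_decomp t : (0 < t)%N -> ~~ exploring im t ->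
  t = (exploit_count t + bracket im t * K)%N.
Proof.
move=> t0 ex; have := round_decomp t0; have [b0 _ _] := round_state t0.
move: ex; rewrite /exploring -leqNgt => ex.
by case: (bracket im t) b0 => // b _ /=; rewrite mulSn; lia.
Qed.

(** Every explore phase yields one used report per agent and allocation, the current phase only once
    the position of that report is reached. *)
Lemma used_explore_count j s t : (0 < t)%N ->
  count (fun r => exploring im r &&
                  (used_at im (bracket im r) j s == position im r)) (iota 1 t)
  = ((bracket im t).-1 + (used_at im (bracket im t) j s <= position im t))%N.
Proof.
have K0 := phase_length_gt0.
case: t => // t _; elim: t => [|t IH].
  rewrite bracket1 position1 /= bracket1 /exploring position1 K0 /=.
  by rewrite leqn0; lia.
have [b0 _ _] := @round_state t.+1 isT.
have Hu := used_at_lt im (bracket im t.+1) j s.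
have Hu' := used_at_lt im (bracket im t.+2) j s.
rewrite iota1S count_cat IH /= addn0 /exploring.
have [[E -> _]|[E -> E']] := @round_next t.+1 isT; rewrite E in Hu' *.
  by move: Hu; case: ltnP => /=; lia.
rewrite K0 /= leqn0.
have -> : (used_at im (bracket im t.+1) j s <= position im t.+1)%N by lia.
by lia.
Qed.

Lemma used_explore_count_exploit j s t : (0 < t)%N -> ~~ exploring im t ->
  count (fun r => exploring im r &&
                  (used_at im (bracket im r) j s == position im r)) (iota 1 t.-1)
  = bracket im t.
Proof.
case: t => // t _ ex; move: (@used_explore_count j s t.+1 isT).
have [b0 _ _] := @round_state t.+1 isT.
rewrite iota1S count_cat /= (negbTE ex) /= !addn0 => ->.
have := used_at_lt im (bracket im t.+1) j s; move: ex.
by rewrite /exploring -leqNgt; lia.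
Qed.

Lemma exploit_length_le q :
  (exploit_length im q)%:R <= 5 / 6 * K%:R * Num.sqrt q%:R :> R.
Proof.
by rewrite /exploit_length truncn_le // mulr_ge0 // ?mulr_ge0.
Qed.

Lemma exploit_length_ge q :
  5 / 6 * K%:R * Num.sqrt q%:R <= (K + exploit_length im q)%:R :> R.
Proof.
apply: ltW; apply: (lt_le_trans (truncnS_gt _)); rewrite ler_nat -/(exploit_length im q).
by have := phase_length_gt0; lia.
Qed.

(** Bracket [q] has at most [5/6 * K * sqrt q] exploit rounds, each contributing [1 / sqrt q], so it
    adds at most [5/6 * K] whatever [q] is. *)
Lemma sum_inv_sqrt_bracket T : (0 < T)%N ->
  \sum_(1 <= t < T.+1 | ~~ exploring im t) (Num.sqrt (bracket im t)%:R)^-1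
    <= 5 / 6 * K%:R * (bracket im T)%:R :> R.
Proof.
have K0 := phase_length_gt0.
(* The induction counts the rounds of the current bracket exactly; the truncated subtraction gives 0
   during its explore phase. *)
suff H t : (0 < t)%N ->
    \sum_(1 <= r < t.+1 | ~~ exploring im r) (Num.sqrt (bracket im r)%:R)^-1
    <= 5 / 6 * K%:R * ((bracket im t).-1)%:R
       + ((position im t).+1 - K)%:R / Num.sqrt (bracket im t)%:R :> R.
  move=> T0; apply: (le_trans (H T T0)); have [b0 _ pT] := round_state T0.
  have sq0 : 0 < Num.sqrt (bracket im T)%:R :> R by rewrite sqrtr_gt0 ltr0n.
  have : ((position im T).+1 - K)%:R / Num.sqrt (bracket im T)%:R <= 5 / 6 * K%:R :> R.
    rewrite ler_pdivrMr //; apply: le_trans (exploit_length_le _).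
    by rewrite ler_nat; lia.
  case: (bracket im T) b0 => // b _.
  by rewrite /= -[b.+1%:R]natr1; nra.
case: t => // t _; elim: t => [|t IH].
  rewrite big_mkcond big_nat1 bracket1 position1 /exploring position1 K0 /= mulr0.
  by rewrite add0r; apply: divr_ge0; rewrite ?sqrtr_ge0.
rewrite big_mkcond big_nat_recr //= -big_mkcond /=.
have [b0 _ _] := @round_state t.+1 isT.
have sq0 : 0 < Num.sqrt (bracket im t.+1)%:R :> R by rewrite sqrtr_gt0 ltr0n.
have [[E E1 p]|[E E1 p]] := @round_next t.+1 isT;
    rewrite [exploring im t.+2]/exploring E1 E.
  rewrite -leqNgt; case: ifPn => [Kp|Kp].
    have -> : ((position im t.+1).+2 - K)%:R = ((position im t.+1).+1 - K)%:R + 1 :> R.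
      by rewrite subSn // natr1.
    by rewrite (mulrDl _ 1) div1r addrA; exact: lerD.
  rewrite addr0; apply: le_trans IH _.
  by rewrite lerD2l ler_pM2r ?invr_gt0 // ler_nat; lia.
rewrite K0 /= addr0; apply: le_trans IH _.
have -> : (1 - K)%N = 0%N by lia.
have bE : (bracket im t.+1).+1.-1%:R = (bracket im t.+1).-1%:R + 1 :> R.
  by rewrite natr1 prednK.
rewrite mul0r addr0 p addKn bE mulrDr mulr1 lerD2l ler_pdivrMr //.
by rewrite natr1 prednK //; exact: exploit_length_le.
Qed.

(** Telescoping: on exploit rounds the counter runs through 1, 2, 3, ..., and
    [1/(x+1)^2 <= 1/x - 1/(x+1)] with difference [1/(x*(x+1)^2)]. *)
Lemma sum_inv_exploit_count_sq T :
  \sum_(1 <= t < T.+1 | ~~ exploring im t) ((exploit_count t).+1%:R ^+ 2)^-1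
    <= 1 - ((exploit_count T).+1%:R)^-1 :> R.
Proof.
elim: T => [|T IH]; first by rewrite big_geq // /exploit_count /= invr1 subrr.
rewrite big_mkcond big_nat_recr //= -big_mkcond /=.
case: ifPn => ex; last by rewrite addr0 exploit_countS (negbTE ex) addn0.
apply: le_trans (lerD IH (lexx _)) _; rewrite exploit_countS ex addn1.
set a := exploit_count T; rewrite -[a.+2]addn1 natrD.
have a0 : 1 <= a.+1%:R :> R by rewrite ler1n.
set x : R := a.+1%:R in a0 *; rewrite /= mulr1n.
rewrite -addrA lerD2l addrC -subr_ge0.
have -> : - (x + 1)^-1 - (((x + 1) ^+ 2)^-1 - x^-1) = (x * (x + 1) ^+ 2)^-1.
  by field; apply/andP; split; rewrite gt_eqF //; lra.
by rewrite invr_ge0 mulr_ge0 ?sqr_ge0 //; lra.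
Qed.

(** The finished brackets, of total length at least [5/9 * K * a^(3/2)] for [a = q - 1], fit into
    [T]. The cases [a <= 3] and [a >= 4] below give the constants 16 and 162/25; 193/10 is what the
    constant 10 of the theorem leaves room for. *)
Lemma bracket_cube T : (2 * K < T)%N ->
  (bracket im T)%:R ^+ 3 * K%:R ^+ 2 <= 193 / 10 * T%:R ^+ 2 :> R.
Proof.
move=> KT; have K0 := phase_length_gt0; have T0 : (0 < T)%N by lia.
have [b0 TE _] := round_state T0; set q := bracket im T in b0 TE *.
have Kr : 1 <= K%:R :> R by rewrite ler1n.
(* What the floor removes from a bracket is made up by its explore phase, of length at least 1. *)
have sumT : 5 / 6 * K%:R * (\sum_(1 <= r < q) Num.sqrt r%:R) <= T%:R :> R.
  have : (bracket_start im q)%:R <= T%:R :> R by rewrite ler_nat; lia.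
  apply: le_trans; rewrite /bracket_start natr_sum mulr_sumr.
  by apply: ler_sum => r _; exact: exploit_length_ge.
(* Discrete form of the integral of the square root: with [y^2 = x^2 + 1] the induction step is
   [2/3 * (y^3 - x^3) <= y]. *)
have sum_sqrt a : 2 / 3 * (a%:R * Num.sqrt a%:R) <= \sum_(1 <= r < a.+1) Num.sqrt r%:R :> R.
  elim: a => [|a IH]; first by rewrite big_geq // !mul0r mulr0.
  rewrite big_nat_recr //=; apply: le_trans (lerD IH (lexx _)).
  have x2 : Num.sqrt a%:R ^+ 2 = a%:R :> R by rewrite sqr_sqrtr.
  have y2 : Num.sqrt a.+1%:R ^+ 2 = a%:R + 1 :> R by rewrite sqr_sqrtr // -natr1.
  move: x2 y2; set x := Num.sqrt a%:R; set y := Num.sqrt a.+1%:R => x2 y2.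
  have x0 : 0 <= x by exact: sqrtr_ge0.
  have y0 : 0 <= y by exact: sqrtr_ge0.
  have E : y ^+ 2 = x ^+ 2 + 1 by rewrite y2 x2.
  have xy : x <= y by rewrite -ler_sqr ?nnegrE // E lerDl.
  have -> : a.+1%:R = y ^+ 2 :> R by rewrite y2 natr1.
  rewrite -x2; have h1 : 2 * (x * (y - x)) <= 1 by nra.
  have h2 : 2 * (x * (x * (y - x))) <= x by nra.
  nra.
have KT' : 2 * K%:R <= T%:R :> R by rewrite -natrM ler_nat; lia.
case: q b0 TE sumT => // a _ TE sumT.
(* With at most four brackets [T > 2 * K] is enough; beyond, [(a+1)^3 <= 2 * a^3]. *)
have [a3|a4] := leqP a 3.
  have : a.+1%:R ^+ 3 <= 64 :> R.
    by rewrite -natrX ler_nat (@leq_exp2r _ 4 3).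
  set A : R := a.+1%:R ^+ 3 => A64.
  have k2 : 0 <= K%:R ^+ 2 :> R by exact: sqr_ge0.
  have : 4 * K%:R ^+ 2 <= T%:R ^+ 2 :> R by nra.
  nra.
have h1 : 5 / 9 * K%:R * (a%:R * Num.sqrt a%:R) <= T%:R :> R.
  apply: le_trans sumT; have := sum_sqrt a; nra.
have ar : 4 <= a%:R :> R by rewrite ler_nat.
have s0 : 0 <= Num.sqrt a%:R :> R by exact: sqrtr_ge0.
have s2 : Num.sqrt a%:R ^+ 2 = a%:R :> R by rewrite sqr_sqrtr.
have h2 : (5 / 9 * K%:R * (a%:R * Num.sqrt a%:R)) ^+ 2 <= T%:R ^+ 2 :> R.
  by rewrite ler_sqr ?nnegrE // !mulr_ge0 //; lra.
have h3 : 25 / 81 * K%:R ^+ 2 * a%:R ^+ 3 <= T%:R ^+ 2 :> R.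
  apply: le_trans h2; rewrite !exprMn s2 le_eqVlt; apply/orP; left; apply/eqP.
  by field.
have h4 : a.+1%:R ^+ 3 <= 2 * a%:R ^+ 3 :> R.
  by rewrite -[a.+1%:R]natr1; move: (a%:R : R) ar => x ar; nra.
apply: le_trans (ler_wpM2r _ h4) _; first exact: sqr_ge0.
have : 0 <= T%:R ^+ 2 :> R by exact: sqr_ge0.
move: h3; set X := a%:R ^+ 3; set Y := K%:R ^+ 2; set Z := T%:R ^+ 2.
nra.
Qed.

End Rounds.

(** * One round of the mechanism *)

Section Mechanism.
Context {R : realType} {n : nat} {Omega S : finType}.
Variables (pb : @problem R n Omega S) (im : implementation pb) (sigma : R).
Local Notation K := (phase_length im).

Implicit Types (est : estimation) (st : 'I_n -> @strategy R S).
Implicit Types (h : seq (@round_record R n Omega)).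

(** A bid is an estimate of width zero, so [center] and [spread] treat both forms of participation
    alike. *)
Definition center est st h j s : R :=
  match st j with Bids b => b s | Reports _ => clipped_mean im est h j s end.

Definition spread est st t h j s : R :=
  match st j with Bids b => 0 | Reports _ => width im sigma est t h j s end.

(** The numerator under the root in [width], with [t - q * K] replaced by the exploit count; the two
    agree on exploit rounds. *)
Definition log_factor (t : nat) : R :=
  5 * ln (exploit_count im t).+1%:R + 2 * ln #|S|%:R.

(** The width for [bracket im t] samples, a lower bound for the number of samples on an exploit
    round. *)
Definition radius (t : nat) : R :=
  sigma * Num.sqrt (log_factor t / (bracket im t)%:R).

Lemma upperE est st t h j s : upper im sigma est st t h j s =
  center est st h j s + spread est st t h j s.
Proof. by rewrite /upper /center /spread; case: (st j) => // b; rewrite addr0. Qed.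

Lemma lowerE est st t h j s : lower im sigma est st t h j s =
  center est st h j s - spread est st t h j s.
Proof. by rewrite /lower /center /spread; case: (st j) => // b; rewrite subr0. Qed.

Lemma clipped_mean_range est (h : seq round_record) j s :
  0 <= clipped_mean im est h j s <= 1.
Proof.
rewrite /clipped_mean le_max lexx /= ge_max ler01 /=.
by rewrite ge_min lexx.
Qed.

Lemma ge0_spread est st t h j s : 0 <= sigma -> 0 <= spread est st t h j s.
Proof.
by move=> s0; rewrite /spread; case: (st j) => // f; rewrite mulr_ge0 ?sqrtr_ge0.
Qed.

Lemma ge0_radius t : 0 <= sigma -> 0 <= radius t.
Proof. by move=> s0; rewrite mulr_ge0 ?sqrtr_ge0. Qed.

Lemma ge0_log_factor t : (0 < #|S|)%N -> 0 <= log_factor t.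
Proof. by move=> c; rewrite addr_ge0 // mulr_ge0 // ln_ge0 // ler1n. Qed.

Lemma welfareE est st t h o (i : 'I_n) :
  welfare im sigma est st t h o =
  seller_value pb o + \sum_(j < n | j != i) upper im sigma est st t h j (alloc pb j o)
  + upper im sigma est st t h i (alloc pb i o).
Proof. by rewrite /welfare (bigD1 i) //= -addrA [X in _ + X]addrC. Qed.

Lemma exploit_outcome_max est st t h o :
  welfare im sigma est st t h o <=
  welfare im sigma est st t h (exploit_outcome im sigma est st t h).
Proof.
rewrite /exploit_outcome; set A := (X in tie_break _ _ X).
have : tie_break im t A \in A.
  apply: tie_breakP; apply/set0Pn.
  have [ x _ mo'] := @Order.TotalTheory.arg_maxP _ _ _ o predT
    (welfare im sigma est st t h) isT.
  by exists x; rewrite inE; apply/forallP => o''; exact: mo'.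
by rewrite inE => /forallP; exact.
Qed.

Lemma exploit_price_ge est pr st t h i o :
  F_others im sigma est pr st t h i o -
  G_others im sigma est pr st t h i (exploit_outcome im sigma est st t h)
  <= exploit_price im sigma est pr st t h i.
Proof. by rewrite lerD2r; exact: le_bigmax. Qed.

Lemma exploit_price_attained est pr st t h i :
  exists o, exploit_price im sigma est pr st t h i =
    F_others im sigma est pr st t h i o -
    G_others im sigma est pr st t h i (exploit_outcome im sigma est st t h).
Proof.
rewrite /exploit_price; set F := F_others _ _ _ _ _ _ _ _.
suff [ o ->] : exists o, \big[Num.max/F (explore_seq im 0)]_o0 F o0 = F o by exists o.
elim/big_ind: _ => [|x y [ o ->] [ o' ->]| o _]; [by exists (explore_seq im 0)| |by exists o].
by rewrite /Num.max; case: ifP => _; [exists o'|exists o].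
Qed.

Definition round_utility est pr st t h i : R :=
  value pb i (alloc pb i (exploit_outcome im sigma est st t h)) -
  exploit_price im sigma est pr st t h i.

Lemma sum_others_le (i : 'I_n) (F : 'I_n -> R) (y : R) :
  0 <= y -> (forall j, j != i -> F j <= y) -> \sum_(j < n | j != i) F j <= n%:R * y.
Proof.
move=> y0 Fy; apply: (le_trans (ler_sum _ Fy)).
rewrite sumr_const -[leLHS]mulr_natl ler_wpM2r // ler_nat.
by apply: leq_trans (max_card _) _; rewrite card_ord.
Qed.

Lemma sum_others_dist (i : 'I_n) (F G : 'I_n -> R) (y : R) :
  0 <= y -> (forall j, j != i -> F j - G j <= y) ->
  \sum_(j < n | j != i) F j - \sum_(j < n | j != i) G j <= n%:R * y.
Proof. by move=> y0 FG; rewrite -sumrB; exact: sum_others_le. Qed.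

Section OptRound.
Variables (pr : pricing) (est : estimation) (i : 'I_n) (t : nat) (w : R).
Variables (st st' : 'I_n -> @strategy R S) (h h' : seq (@round_record R n Omega)).
Hypothesis spread_st : forall j s, 0 <= spread est st t h j s <= w.
Hypothesis spread_st' : forall j s, 0 <= spread est st' t h' j s <= w.

Local Notation vi o := (value pb i (alloc pb i o)).

(** No accuracy of the estimates is assumed. On the first run the price is at least
    [F_others - G_others] at the chosen outcome, hence at least [- 2 * n * w]. On the second run the
    optimality of [o'] for the upper estimates bounds the price, up to [2 * n * w], by a difference
    of two upper estimates of agent [i], at most [1 + w]. *)
Lemma round_gain_unconditional :
  (forall s, 0 <= center est st' h' i s <= 1) ->
  round_utility est pr st t h i - round_utility est pr st' t h' i <=
  2 + (4 * n%:R + 1) * w.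
Proof.
move=> ci.
set o := exploit_outcome im sigma est st t h.
set o' := exploit_outcome im sigma est st' t h'.
have w0 : 0 <= w by have := spread_st i (alloc pb i o); lra.
have u1 : round_utility est pr st t h i <= 1 + n%:R * (2 * w).
  have := exploit_price_ge est pr st t h i o; rewrite -/o => pge.
  have gf : G_others im sigma est pr st t h i o - F_others im sigma est pr st t h i o
      <= n%:R * (2 * w).
    rewrite /G_others /F_others opprD addrACA subrr add0r.
    apply: sum_others_dist => [|j _]; first by lra.
      have := spread_st j (alloc pb j o).
      by rewrite /g_est /f_est; case: (pr); rewrite upperE lowerE; lra.
  have /andP[_ v1] := value_range pb i (alloc pb i o).
  by rewrite /round_utility -/o; lra.
suff u2 : - 1 - w - n%:R * (2 * w) <= round_utility est pr st' t h' i by lra.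
have [ o2 po2] := exploit_price_attained est pr st' t h' i.
rewrite /round_utility -/o' po2 -/o'.
have wf := exploit_outcome_max est st' t h' o2; rewrite -/o' !(welfareE _ _ _ _ _ i) in wf.
have gU : seller_value pb o' +
    \sum_(j < n | j != i) upper im sigma est st' t h' j (alloc pb j o')
    - n%:R * (2 * w) <= G_others im sigma est pr st' t h' i o'.
  rewrite /G_others -addrA lerD2l lerBlDr -lerBlDl.
  apply: sum_others_dist => [|j _]; first by lra.
    have := spread_st' j (alloc pb j o').
    by rewrite /g_est; case: (pr); rewrite !upperE ?lowerE; lra.
have fU : F_others im sigma est pr st' t h' i o2 <= seller_value pb o2 +
    \sum_(j < n | j != i) upper im sigma est st' t h' j (alloc pb j o2).
  rewrite /F_others lerD2l; apply: ler_sum => j _.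
  have := spread_st' j (alloc pb j o2).
  by rewrite /f_est; case: (pr); rewrite !upperE ?lowerE; lra.
have /andP[v0 _] := value_range pb i (alloc pb i o').
rewrite !upperE in wf.
have := ci (alloc pb i o'); have := ci (alloc pb i o2).
have := spread_st' i (alloc pb i o'); have := spread_st' i (alloc pb i o2).
lra.
Qed.

Variable V : 'I_n -> S -> R.
Hypothesis good : forall j s, j != i ->
  `|center est st h j s - V j s| <= 2 * spread est st t h j s.
Hypothesis good' : forall j s, j != i ->
  `|center est st' h' j s - V j s| <= 2 * spread est st' t h' j s.
Hypothesis goodi : forall s,
  `|center est st' h' i s - value pb i s| <= 2 * spread est st' t h' i s.

Local Definition V_others o := seller_value pb o + \sum_(j < n | j != i) V j (alloc pb j o).

(** The outcome [o2] that attains the truthful price also serves as a competitor in the other price,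
    so [V_others o2] cancels. What remains is a difference of limit welfares, which is small because
    [o'] maximises the estimated welfare. *)
Lemma round_gain_good :
  round_utility est pr st t h i - round_utility est pr st' t h' i <=
  12 * n%:R * w.
Proof.
set o := exploit_outcome im sigma est st t h.
set o' := exploit_outcome im sigma est st' t h'.
have w0 : 0 <= w by have := spread_st i (alloc pb i o); lra.
have [ o2 po2] := exploit_price_attained est pr st' t h' i.
have pge := exploit_price_ge est pr st t h i o2.
rewrite /round_utility -/o -/o' in po2 pge *; rewrite po2.
(* An error is [3 * w] where the confidence term adds to the estimation error and [w] where it
   opposes it; the pricing decides which run gets which. Per agent, the two maxima cost [a + b], and
   so do the two subtracted terms: [8 * n * w] in all, to which [WF] adds [4 * n * w]. *)
pose a := if pr is AGE then w else 3 * w; pose b := if pr is AGE then 3 * w else w.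
have a0 : 0 <= a by rewrite /a; case: (pr); lra.
have b0 : 0 <= b by rewrite /b; case: (pr); lra.
have ab : a + b = 4 * w by rewrite /a /b; case: (pr); lra.
have G1 : G_others im sigma est pr st t h i o <= V_others o + n%:R * b.
  rewrite /G_others /V_others -addrA lerD2l -lerBlDl.
  apply: sum_others_dist => //.
  move=> j /(@good j (alloc pb j o)); rewrite ler_norml.
  have := spread_st j (alloc pb j o).
  by rewrite /g_est /a /b; case: (pr); rewrite ?upperE ?lowerE; lra.
have F1 : V_others o2 - n%:R * b <= F_others im sigma est pr st t h i o2.
  rewrite /F_others /V_others -addrA lerD2l lerBlDr -lerBlDl.
  apply: sum_others_dist => //.
  move=> j /(@good j (alloc pb j o2)); rewrite ler_norml.
  have := spread_st j (alloc pb j o2).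
  by rewrite /f_est /a /b; case: (pr); rewrite ?upperE ?lowerE; lra.
have G2 : V_others o' - n%:R * a <= G_others im sigma est pr st' t h' i o'.
  rewrite /G_others /V_others -addrA lerD2l lerBlDr -lerBlDl.
  apply: sum_others_dist => //.
  move=> j /(@good' j (alloc pb j o')); rewrite ler_norml.
  have := spread_st' j (alloc pb j o').
  by rewrite /g_est /a /b; case: (pr); rewrite ?upperE ?lowerE; lra.
have F2 : F_others im sigma est pr st' t h' i o2 <= V_others o2 + n%:R * a.
  rewrite /F_others /V_others -addrA lerD2l -lerBlDl.
  apply: sum_others_dist => //.
  move=> j /(@good' j (alloc pb j o2)); rewrite ler_norml.
  have := spread_st' j (alloc pb j o2).
  by rewrite /f_est /a /b; case: (pr); rewrite ?upperE ?lowerE; lra.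
have WF : vi o + V_others o <= vi o' + V_others o' + 4 * n%:R * w.
  have := exploit_outcome_max est st' t h' o; rewrite -/o'.
  pose U o j := upper im sigma est st' t h' j (alloc pb j o).
  pose V' o j := if j == i then value pb i (alloc pb i o) else V j (alloc pb j o).
  have V'E x : vi x + V_others x = seller_value pb x + \sum_(j < n) V' x j.
    rewrite (bigD1 i) //= /V' eqxx /V_others [RHS]addrCA; congr (_ + (_ + _)).
    by apply: eq_bigr => j /negbTE ->.
  have UV x j : - w <= U x j - V' x j <= 3 * w.
    rewrite /U /V' upperE; have := spread_st' j (alloc pb j x).
    case: eqVneq => [->|ji].
      by move: (goodi (alloc pb i x)); rewrite ler_norml; lra.
    by move: (good' (alloc pb j x) ji); rewrite ler_norml; lra.
  have sumle (H : 'I_n -> R) (y : R) : (forall j, H j <= y) -> \sum_(j < n) H j <= n%:R * y.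
    move=> Hy; apply: le_trans (ler_sum _ (fun j _ => Hy j)) _.
    by rewrite sumr_const card_ord mulr_natl.
  rewrite !V'E /welfare.
  have := sumle (fun j => V' o j - U o j) w (fun j => _).
  have := sumle (fun j => U o' j - V' o' j) (3 * w) (fun j => _).
  rewrite !sumrB => /(_ _)/[swap].
  have h1 j : V' o j - U o j <= w by have := UV o j; lra.
  have h2 j : U o' j - V' o' j <= 3 * w by have := UV o' j; lra.
  by move=> /(_ h1) + /(_ h2); rewrite /U; lra.
have -> : 12 * n%:R * w = 2 * (n%:R * (a + b)) + 4 * n%:R * w by rewrite ab; ring.
lra.
Qed.

End OptRound.

Section EtcRound.
Variables (pr : pricing) (i : 'I_n) (t : nat).
Variables (st st' : 'I_n -> @strategy R S) (h h' : seq (@round_record R n Omega)).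
Variable wd : 'I_n -> R.
Hypothesis spread_const : forall j s, spread ETC st' t h' j s = wd j.
Hypothesis same_center : forall j s, j != i ->
  center ETC st h j s = center ETC st' h' j s.
Hypothesis same_spread : forall j s, j != i ->
  spread ETC st t h j s = spread ETC st' t h' j s.

(** The others are estimated alike on both runs, so the maxima in the two prices cancel. As widths
    do not depend on the allocation, [G_others] is the upper welfare of the others up to a constant,
    and [o'] maximises [G_others] plus the centre of agent [i]. Only her estimation errors at the
    two outcomes are left. *)
Lemma round_gain_ETC : exists s s',
  round_utility ETC pr st t h i - round_utility ETC pr st' t h' i <=
  (value pb i s - center ETC st' h' i s) + (center ETC st' h' i s' - value pb i s').
Proof.
set o := exploit_outcome im sigma ETC st t h.
set o' := exploit_outcome im sigma ETC st' t h'.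
have eu j s : j != i -> upper im sigma ETC st t h j s = upper im sigma ETC st' t h' j s.
  by move=> ji; rewrite !upperE same_center // same_spread.
have el j s : j != i -> lower im sigma ETC st t h j s = lower im sigma ETC st' t h' j s.
  by move=> ji; rewrite !lowerE same_center // same_spread.
have eF : F_others im sigma ETC pr st t h i =1 F_others im sigma ETC pr st' t h' i.
  move=> x; congr (_ + _); apply: eq_bigr => j ji.
  by rewrite /f_est; case: (pr); rewrite ?eu ?el.
have eG : G_others im sigma ETC pr st t h i =1 G_others im sigma ETC pr st' t h' i.
  move=> x; congr (_ + _); apply: eq_bigr => j ji.
  by rewrite /g_est; case: (pr); rewrite ?eu ?el.
exists (alloc pb i o), (alloc pb i o').
rewrite /round_utility /exploit_price -/o -/o' eG.
have -> : \big[Num.max/F_others im sigma ETC pr st t h i (explore_seq im 0)]_x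
     F_others im sigma ETC pr st t h i x =
   \big[Num.max/F_others im sigma ETC pr st' t h' i (explore_seq im 0)]_x
     F_others im sigma ETC pr st' t h' i x.
  by rewrite eF; apply: eq_bigr => x _; rewrite eF.
have [c Gc] : exists c, forall x, G_others im sigma ETC pr st' t h' i x =
    seller_value pb x +
    \sum_(j < n | j != i) upper im sigma ETC st' t h' j (alloc pb j x) - c.
  exists (if pr is AGE then 0 else \sum_(j < n | j != i) (2 * wd j)) => x.
  rewrite /G_others /g_est; case: (pr); first by rewrite subr0.
  rewrite -addrA -sumrB; congr (_ + _); apply: eq_bigr => j ji.
  by rewrite upperE lowerE spread_const; ring.
have := exploit_outcome_max ETC st' t h' o; rewrite -/o' !(welfareE _ _ _ _ _ i).
rewrite !Gc !upperE !spread_const; lra.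
Qed.

End EtcRound.

End Mechanism.

(** * Independence of generated sigma-algebras *)

Section SigmaIndependence.
Context {R : realType} d (W : measurableType d) (P : probability W R).
Context {I : choiceType} (Z : I -> W -> R).
Hypothesis mZ : forall k, measurable_fun setT (Z k).
Hypothesis indepZ : independent_family P Z.

(** The pi-system that generates the sigma-algebra of the variables with index in [Q]. *)
Definition cylinder (Q : pred I) : set (set W) :=
  [set A | exists (J : seq I) (B : I -> set R),
    [/\ uniq J, all Q J, (forall k, measurable (B k)) &
        A = [set w | forall k, k \in J -> B k (Z k w)]]].

Lemma cylinder_setT Q : cylinder Q setT.
Proof.
by exists [::], (fun=> setT); split => //; apply/seteqP; split => // w _ k.
Qed.

Lemma cylinder_measurable Q : cylinder Q `<=` measurable.
Proof.
move=> _ [J [B [_ _ mB ->]]].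
have -> : [set w | forall k, k \in J -> B k (Z k w)] =
    \bigcap_(k in [set` J]) (Z k @^-1` B k) by [].
apply: fin_bigcap_measurable; first exact: finite_seq.
by move=> k _; rewrite -[X in measurable X]setTI; exact: mZ.
Qed.

Lemma cylinder_setI Q : setI_closed (cylinder Q).
Proof.
move=> _ _ [J1 [B1 [u1 q1 m1 ->]]] [J2 [B2 [u2 q2 m2 ->]]].
exists (undup (J1 ++ J2)), (fun k => (if k \in J1 then B1 k else setT) `&`
  (if k \in J2 then B2 k else setT)); split.
- exact: undup_uniq.
- by apply/allP => k; rewrite mem_undup mem_cat => /orP[/(allP q1)|/(allP q2)].
- by move=> k; apply: measurableI; case: ifP.
- apply/seteqP; split => w /=.
    by move=> [h1 h2] k; split; case: ifP => // kJ; [exact: h1|exact: h2].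
  move=> h; split => k kJ.
    by have [] := h k; rewrite ?mem_undup ?mem_cat ?kJ.
  by have [] := h k; rewrite ?mem_undup ?mem_cat ?kJ ?orbT.
Qed.

Lemma cylinder_indep (Q1 Q2 : pred I) A1 A2 : (forall k, Q1 k -> ~~ Q2 k) ->
  cylinder Q1 A1 -> cylinder Q2 A2 -> P (A1 `&` A2) = (P A1 * P A2)%E.
Proof.
move=> Q12 [J1 [B1 [u1 q1 m1 ->]]] [J2 [B2 [u2 q2 m2 ->]]].
pose B k := if k \in J1 then B1 k else B2 k.
have J12 k : k \in J2 -> k \in J1 = false.
  move=> /(allP q2) k2; apply/negP => /(allP q1) /Q12; by rewrite k2.
have uJ : uniq (J1 ++ J2).
  rewrite cat_uniq u1 u2 andbT /=; apply/hasPn => k /J12 -> //.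
have -> : [set w | forall k, k \in J1 -> B1 k (Z k w)] `&`
    [set w | forall k, k \in J2 -> B2 k (Z k w)] =
    [set w | forall k, k \in J1 ++ J2 -> B k (Z k w)].
  apply/seteqP; split => w /=.
    move=> [h1 h2] k; rewrite /B mem_cat.
    by case: ifP => [k1 _|_ /=]; [exact: h1|exact: h2].
  move=> h; split => k kJ; have := h k; rewrite mem_cat kJ ?orbT => /(_ isT).
    by rewrite /B kJ.
  by rewrite /B J12.
rewrite !indepZ // => [|k]; last by rewrite /B; case: ifP.
rewrite big_cat /=; congr (_ * _)%E.
  by apply: eq_big_seq => k kJ; rewrite /B kJ.
by apply: eq_big_seq => k kJ; rewrite /B J12.
Qed.

Lemma sigma_cylinder_measurable Q : <<s cylinder Q >> `<=` measurable.
Proof.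
apply: smallest_sub; first exact: sigma_algebra_measurable.
exact: cylinder_measurable.
Qed.

(** A pi-lambda argument made twice, once for each factor: for fixed [A], the finite measures
    [P (B & A)] and [P A * P B] in [B] agree on the pi-system, hence on the sigma-algebra generated
    by it. *)
Lemma sigma_cylinder_indep (Q1 Q2 : pred I) A1 A2 : (forall k, Q1 k -> ~~ Q2 k) ->
  <<s cylinder Q1 >> A1 -> <<s cylinder Q2 >> A2 ->
  P (A1 `&` A2) = (P A1 * P A2)%E.
Proof.
move=> Q12; suff H (G : set (set W)) A : measurable A ->
    (forall B, G B -> P (B `&` A) = (P B * P A)%E) ->
    (exists Q, G = cylinder Q) -> forall B, <<s G >> B ->
    P (B `&` A) = (P B * P A)%E.
  move=> s1 s2; have mA2 := sigma_cylinder_measurable s2.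
  apply: (H (cylinder Q1)) => //; last by exists Q1.
  move=> B B1; have mB := cylinder_measurable B1.
  rewrite setIC muleC; apply: (H (cylinder Q2)) => //; last by exists Q2.
  by move=> C C2; rewrite setIC muleC; exact: cylinder_indep B1 C2.
move=> mA GA [Q GQ] B sB; rewrite GQ {G GQ} in GA sB *.
have PA0 : 0 <= fine (P A) by exact: fine_ge0.
have key : mrestr P mA B = mscale (NngNum PA0) P B.
  apply: (g_sigma_algebra_measure_unique (cylinder Q) _ (fun=> setT)) => //.
  - exact: cylinder_measurable.
  - by move=> _; exact: cylinder_setT.
  - by apply/seteqP; split => // w _; exists 0%N.
  - exact: cylinder_setI.
  - move=> C /GA; rewrite /= /mrestr /mscale /= => ->.
    by rewrite fineK ?fin_num_measure // muleC.
  - move=> k; rewrite /= /mrestr setTI.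
    by apply: le_lt_trans (probability_le1 _ mA) _; rewrite ltry.
move: key; rewrite /mrestr /mscale /= => ->.
by rewrite fineK ?fin_num_measure // muleC.
Qed.

Local Open Scope ereal_scope.

(** Independence makes the law of the pair the product of the two laws, and Tonelli applies since
    both factors are nonnegative; no integrability is required. *)
Lemma expectation_prod_sigma (Q1 Q2 : pred I) (f g : W -> R) :
  (forall k, Q1 k -> ~~ Q2 k) ->
  measurable_fun [set: g_sigma_algebraType (cylinder Q1)] f ->
  measurable_fun [set: g_sigma_algebraType (cylinder Q2)] g ->
  (forall w, 0 <= f w)%R -> (forall w, 0 <= g w)%R ->
  \int[P]_w (f w * g w)%:E = (\int[P]_w (f w)%:E) * (\int[P]_w (g w)%:E).
Proof.
move=> Q12 mf mg f0 g0.
have sf B : measurable B -> <<s cylinder Q1 >> (f @^-1` B).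
  by move=> mB; have := mf measurableT B mB; rewrite setTI.
have sg B : measurable B -> <<s cylinder Q2 >> (g @^-1` B).
  by move=> mB; have := mg measurableT B mB; rewrite setTI.
have mfW : measurable_fun [set: W] f.
  by move=> _ B mB; rewrite setTI; apply: sigma_cylinder_measurable (sf B mB).
have mgW : measurable_fun [set: W] g.
  by move=> _ B mB; rewrite setTI; apply: sigma_cylinder_measurable (sg B mB).
have mfg : measurable_fun [set: W] (fun w => (f w, g w)).
  exact/measurable_fun_pair.
pose F : {RV P >-> R} := HB.pack f (isMeasurableFun.Build _ _ _ _ f mfW).
pose G : {RV P >-> R} := HB.pack g (isMeasurableFun.Build _ _ _ _ g mgW).
pose FG : {RV P >-> (R * R)%type} :=
  HB.pack (fun w => (f w, g w)) (isMeasurableFun.Build _ _ _ _ _ mfg).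
(* Truncation at 0 makes the integrand nonnegative on the whole plane without changing it at the
   values of [f] and [g]. *)
pose h (u : measurableTypeR R * measurableTypeR R) : \bar R :=
  (Num.max 0 u.1)%:E * (Num.max 0 u.2)%:E.
have mh : measurable_fun setT h.
  apply: emeasurable_funM; apply/measurable_EFinP; apply: measurable_maxr => //.
have h0 u : 0 <= h u by rewrite mule_ge0 // lee_fin le_max lexx.
transitivity (\int[distribution P FG]_u h u).
  rewrite ge0_integral_distribution //; apply: eq_integral => w _ /=.
  by rewrite /h /= !max_r ?f0 ?g0.
transitivity (\int[distribution P F \x distribution P G]_u h u).
  apply: eq_measure_integral => A mA _; symmetry.
  apply: product_measure_unique => // B C mB mC.
  exact: (sigma_cylinder_indep Q12 (sf B mB) (sg C mC)).
rewrite fubini_tonelli1 //.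
have -> : \int[P]_w (f w)%:E = \int[distribution P F]_x (Num.max 0%R x)%:E.
  rewrite ge0_integral_distribution //.
  - by apply: eq_integral => w _ /=; rewrite max_r ?f0.
  - by apply/measurable_EFinP; exact: measurable_maxr.
  - by move=> y; rewrite lee_fin le_max lexx.
have -> : \int[P]_w (g w)%:E = \int[distribution P G]_x (Num.max 0%R x)%:E.
  rewrite ge0_integral_distribution //.
  - by apply: eq_integral => w _ /=; rewrite max_r ?g0.
  - by apply/measurable_EFinP; exact: measurable_maxr.
  - by move=> y; rewrite lee_fin le_max lexx.
have mm : measurable_fun [set: R] (fun x : R => (Num.max 0%R x)%:E).
  by apply/measurable_EFinP; exact: measurable_maxr.
have m0 (x : R) : 0 <= (Num.max 0%R x)%:E by rewrite lee_fin le_max lexx.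
rewrite -ge0_integralZr //; last exact: integral_ge0.
apply: eq_integral => x _; rewrite /fubini_F /h /=.
by rewrite ge0_integralZl.
Qed.

End SigmaIndependence.

(** * Measurability of the history *)

Section FiniteValued.
Context d (W : measurableType d).

(** Outcomes and allocations carry no sigma-algebra; for finitely many values the preimages of
    points determine measurability. *)
Definition finite_measurable {fT : finType} (u : W -> fT) : Prop :=
  forall v, measurable (u @^-1` [set v]).

Lemma finite_measurable_preimage (fT : finType) (u : W -> fT) (A : set fT) :
  finite_measurable u -> measurable (u @^-1` A).
Proof.
move=> mu; have -> : u @^-1` A = \bigcup_(v in A) (u @^-1` [set v]).
  by apply/seteqP; split => [w Aw|w [v Av /= ->]] //=; exists (u w).
by apply: fin_bigcup_measurable => [|v _]; [exact: finite_finset|exact: mu].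
Qed.

Lemma finite_measurable_comp (fT gT : finType) (g : fT -> gT) (u : W -> fT) :
  finite_measurable u -> finite_measurable (fun w => g (u w)).
Proof. by move=> mu v; exact: (finite_measurable_preimage (g @^-1` [set v])). Qed.

Lemma finite_measurable_cst (fT : finType) (v : fT) :
  finite_measurable (fun=> v).
Proof.
move=> v'; rewrite (_ : _ @^-1` _ = [set _ | v = v']) //.
have [->|vv'] := eqVneq v v'; first by rewrite (_ : [set _ | _] = setT) // -subTset.
rewrite (_ : [set _ | _] = set0) // -subset0 => w /= vv.
by rewrite vv eqxx in vv'.
Qed.

Lemma finite_measurable_ffun (I fT : finType) (u : I -> W -> fT) :
  (forall k, finite_measurable (u k)) ->
  finite_measurable (fun w => [ffun k => u k w]).
Proof.
move=> mu v; have -> : (fun w => [ffun k => u k w]) @^-1` [set v] =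
    \bigcap_(k in [set: I]) (u k @^-1` [set v k]).
  apply/seteqP; split => w /=; first by move=> <- k _; rewrite /= ffunE.
  by move=> H; apply/ffunP => k; rewrite ffunE; exact: H.
by apply: fin_bigcap_measurable => [|k _]; [exact: finite_finset|exact: mu].
Qed.

Lemma finite_measurable_pair (fT gT : finType) (u : W -> fT) (v : W -> gT) :
  finite_measurable u -> finite_measurable v ->
  finite_measurable (fun w => (u w, v w)).
Proof.
move=> mu mv [a b]; have -> : (fun w => (u w, v w)) @^-1` [set (a, b)] =
    (u @^-1` [set a]) `&` (v @^-1` [set b]).
  by apply/seteqP; split => w /= => [[-> ->]|[-> ->]].
exact: measurableI.
Qed.

Lemma finite_measurable_bool (b : W -> bool) :
  measurable_fun setT b -> finite_measurable b.
Proof. by move=> mb v; rewrite -[X in measurable X]setTI; exact: mb. Qed.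

(** Gluing along the finitely many level sets of [u]: it handles everything selected by a random
    outcome, flag or sequence of allocations. *)
Lemma measurable_fun_finite d' (T : measurableType d') (fT : finType)
    (u : W -> fT) (f : fT -> W -> T) :
  finite_measurable u -> (forall v, measurable_fun setT (f v)) ->
  measurable_fun setT (fun w => f (u w) w).
Proof.
move=> mu mf _ B mB; rewrite setTI.
have -> : (fun w => f (u w) w) @^-1` B =
    \bigcup_(v in [set: fT]) ((u @^-1` [set v]) `&` (f v @^-1` B)).
  apply/seteqP; split => w /=; first by move=> Bw; exists (u w).
  by move=> [v _ [/= <-]].
apply: fin_bigcup_measurable => [|v _]; first exact: finite_finset.
by apply: measurableI => //; rewrite -[X in measurable X]setTI; exact: mf.
Qed.

Lemma measurable_fun_discr d' (T : measurableType d') (N : W -> nat) (g : nat -> T) :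
  measurable_fun setT N -> measurable_fun setT (fun w => g (N w)).
Proof. by move=> mN; apply: (@measurableT_comp _ _ _ _ _ _ g) => // ? B. Qed.

Lemma measurable_fun_bigmax (R : realType) (I : Type) (s : seq I) (f0 : W -> R)
    (f : I -> W -> R) : measurable_fun setT f0 ->
  (forall k, measurable_fun setT (f k)) ->
  measurable_fun setT (fun w => \big[Num.max/f0 w]_(k <- s) f k w).
Proof.
move=> m0 mf; elim: s => [|k s IH].
  by apply: eq_measurable_fun m0 => w _; rewrite big_nil.
apply: (eq_measurable_fun (fun w => Num.max (f k w) (\big[Num.max/f0 w]_(k <- s) f k w))).
  by move=> w _; rewrite big_cons.
exact: measurable_maxr.
Qed.

End FiniteValued.

Section HistoryMeasurable.
Context {R : realType} {n : nat} {Omega S : finType}.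
Variables (pb : @problem R n Omega S) (im : implementation pb) (sigma : R).
Variables (est : estimation) (pr : pricing) (st : 'I_n -> @strategy R S).
Hypothesis st_valid : forall j, valid_strategy (st j).

Definition round_of x z t : round_record :=
  play_round im sigma est pr st t (history im sigma est pr st x z t.-1)
    (fun i => x i t) (fun i => z i t).

Lemma history_map x z T :
  history im sigma est pr st x z T = [seq round_of x z t | t <- iota 1 T].
Proof. by elim: T => // T IH; rewrite iota1S map_cat /= -IH cats1. Qed.

Context d (W : measurableType d).
Variables (x : 'I_n -> nat -> S -> W -> R) (z : 'I_n -> nat -> W -> R).

Let rec t w := round_of (fun i t s => x i t s w) (fun i t => z i t w) t.
Let hist T w :=
  history im sigma est pr st (fun i t s => x i t s w) (fun i t => z i t w) T.

(** The sigma-algebra on [W] is left arbitrary, so that it can be the full one or the one generated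
    by the past. *)
Definition round_measurable t : Prop :=
  finite_measurable (fun w => rd_outcome (rec t w)) /\
  forall j, [/\ measurable_fun setT (fun w => rd_price (rec t w) j),
                measurable_fun setT (fun w => rd_reward (rec t w) j) &
                measurable_fun setT (fun w => rd_report (rec t w) j)].

Lemma finite_measurable_used j s t : round_measurable t ->
  finite_measurable (fun w => used im est j s (rec t w)).
Proof.
move=> [mo _].
exact: (finite_measurable_comp (fun o => used im est j s
  (RoundRecord t o (fun=> 0 : R) (fun=> 0) (fun=> 0))) mo).
Qed.

Lemma measurable_sample_count j s T :
  (forall t, (0 < t <= T)%N -> round_measurable t) ->
  measurable_fun setT (fun w => sample_count im est (hist T w) j s).
Proof.
elim: T => [|T IH] mr; first by [].
apply: (eq_measurable_fun (fun w => sample_count im est (hist T w) j s +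
   (fun b : bool => b : nat) (used im est j s (rec T.+1 w)))%N).
  move=> w _; rewrite /sample_count /hist [in RHS]/= -cats1 count_cat /=.
  by rewrite addn0.
apply: measurable_fun_addn; first by apply: IH => t tT; apply: mr; lia.
apply: (measurable_fun_finite (f := fun (b : bool) _ => b : nat)) => //.
by apply: finite_measurable_used; apply: mr; lia.
Qed.

Lemma measurable_report_sum j s (a : R) T :
  (forall t, (0 < t <= T)%N -> round_measurable t) ->
  measurable_fun setT
    (fun w => \sum_(r <- hist T w | used im est j s r) (rd_report r j - a)).
Proof.
elim: T => [|T IH] mr.
  by apply: (eq_measurable_fun (fun=> 0 : R)) => // w _; rewrite /hist /= big_nil.
apply: (eq_measurable_fun (fun w =>
   \sum_(r <- hist T w | used im est j s r) (rd_report r j - a) +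
   (if used im est j s (rec T.+1 w) then rd_report (rec T.+1 w) j - a else 0))).
  by move=> w _; rewrite /hist [in RHS]/= -cats1 big_cat /= big_cons big_nil addr0.
apply: measurable_funD; first by apply: IH => t tT; apply: mr; lia.
have mT : round_measurable T.+1 by apply: mr; lia.
apply: (measurable_fun_finite (f := fun (b : bool) w =>
  if b then rd_report (rec T.+1 w) j - a else 0)).
  exact: finite_measurable_used.
by case => //; apply: measurable_funB => //; case: mT => _ /(_ j)[].
Qed.

Lemma measurable_clipped_mean j s T :
  (forall t, (0 < t <= T)%N -> round_measurable t) ->
  measurable_fun setT (fun w => clipped_mean im est (hist T w) j s).
Proof.
move=> mr; apply: measurable_maxr => //; apply: measurable_minr => //.
apply: measurable_funM.
  apply: eq_measurable_fun (measurable_report_sum j s 0 mr) => w _.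
  by apply: eq_bigr => r _; rewrite subr0.
exact: (measurable_fun_discr (fun N => N%:R^-1 : R) (measurable_sample_count j s mr)).
Qed.

Lemma measurable_width j s t T :
  (forall t, (0 < t <= T)%N -> round_measurable t) ->
  measurable_fun setT (fun w => width im sigma est t (hist T w) j s).
Proof.
move=> mr; exact: (measurable_fun_discr (fun N => sigma * Num.sqrt
    ((5 * ln (t%:R - (bracket im t * phase_length im)%:R + 1) + 2 * ln #|S|%:R)
       / N%:R) : R) (measurable_sample_count j s mr)).
Qed.

Lemma measurable_upper j s t T :
  (forall t, (0 < t <= T)%N -> round_measurable t) ->
  measurable_fun setT (fun w => upper im sigma est st t (hist T w) j s).
Proof.
move=> mr; rewrite /upper; case: (st j) => // f.
by apply: measurable_funD; [exact: measurable_clipped_mean|exact: measurable_width].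
Qed.

Lemma measurable_lower j s t T :
  (forall t, (0 < t <= T)%N -> round_measurable t) ->
  measurable_fun setT (fun w => lower im sigma est st t (hist T w) j s).
Proof.
move=> mr; rewrite /lower; case: (st j) => // f.
by apply: measurable_funB; [exact: measurable_clipped_mean|exact: measurable_width].
Qed.

Lemma measurable_welfare t T o :
  (forall t, (0 < t <= T)%N -> round_measurable t) ->
  measurable_fun setT (fun w => welfare im sigma est st t (hist T w) o).
Proof.
move=> mr; apply: measurable_funD => //.
by apply: measurable_sum => j; exact: measurable_upper.
Qed.

Lemma finite_measurable_exploit_outcome t T :
  (forall t, (0 < t <= T)%N -> round_measurable t) ->
  finite_measurable (fun w => exploit_outcome im sigma est st t (hist T w)).
Proof.
(* [tie_break] is an arbitrary function of the argmax, which is determined by the finite table of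
   pairwise comparisons of welfare; each entry of the table is measurable. *)
move=> mr; pose best (c : {ffun Omega * Omega -> bool}) :=
  tie_break im t [set o | [forall o', c (o', o)]]%SET.
rewrite (_ : (fun w => _) = fun w => best [ffun oo =>
    welfare im sigma est st t (hist T w) oo.1 <=
    welfare im sigma est st t (hist T w) oo.2]); last first.
  apply/funext => w; rewrite /exploit_outcome; congr tie_break.
  by apply/setP => o; rewrite !inE; apply: eq_forallb => o'; rewrite ffunE.
apply: finite_measurable_comp; apply: finite_measurable_ffun => oo.
by apply: finite_measurable_bool; apply: measurable_fun_ler; exact: measurable_welfare.
Qed.

Lemma finite_measurable_outcome t T :
  (forall t, (0 < t <= T)%N -> round_measurable t) ->
  finite_measurable (fun w => outcome_at im sigma est st t (hist T w)).
Proof.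
move=> mr; rewrite /outcome_at; case: (exploring im t); first exact: finite_measurable_cst.
exact: finite_measurable_exploit_outcome.
Qed.

Lemma measurable_F_others t T j o :
  (forall t, (0 < t <= T)%N -> round_measurable t) ->
  measurable_fun setT (fun w => F_others im sigma est pr st t (hist T w) j o).
Proof.
move=> mr; apply: measurable_funD => //.
rewrite (_ : (fun w => _) = fun w => \sum_(k <- [seq k <- index_enum 'I_n | k != j])
    f_est im sigma est pr st t (hist T w) k (alloc pb k o)); last first.
  by apply/funext => w; rewrite big_filter.
apply: measurable_sum => k.
by rewrite /f_est; case: (pr); [exact: measurable_lower|exact: measurable_upper].
Qed.

Lemma measurable_G_others t T j o :
  (forall t, (0 < t <= T)%N -> round_measurable t) ->
  measurable_fun setT (fun w => G_others im sigma est pr st t (hist T w) j o).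
Proof.
move=> mr; apply: measurable_funD => //.
rewrite (_ : (fun w => _) = fun w => \sum_(k <- [seq k <- index_enum 'I_n | k != j])
    g_est im sigma est pr st t (hist T w) k (alloc pb k o)); last first.
  by apply/funext => w; rewrite big_filter.
apply: measurable_sum => k.
by rewrite /g_est; case: (pr); [exact: measurable_upper|exact: measurable_lower].
Qed.

Lemma measurable_price t T j :
  (forall t, (0 < t <= T)%N -> round_measurable t) ->
  measurable_fun setT (fun w => price_at im sigma est pr st t (hist T w) j).
Proof.
move=> mr; rewrite /price_at; case: (exploring im t) => //.
apply: measurable_funB.
  by apply: measurable_fun_bigmax => [|o]; exact: measurable_F_others.
apply: (measurable_fun_finite (f := fun o w =>
    G_others im sigma est pr st t (hist T w) j o)).
  exact: finite_measurable_exploit_outcome.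
by move=> o; exact: measurable_G_others.
Qed.

Lemma past_of_hist T w j :
  past_of pb (hist T w) j =
  zip [tuple alloc pb j (rd_outcome (rec k.+1 w)) | k < T]
      [tuple (rd_price (rec k.+1 w) j, rd_reward (rec k.+1 w) j,
              rd_report (rec k.+1 w) j) | k < T].
Proof.
rewrite /past_of /hist history_map -map_comp /= -[1%N]addn0 iotaDl -val_enum_ord.
by rewrite -!map_comp zip_map.
Qed.

Lemma round_measurable_succ T :
  (forall t, (0 < t <= T)%N -> round_measurable t) ->
  (forall j s, measurable_fun setT (x j T.+1 s)) ->
  (forall j, measurable_fun setT (z j T.+1)) -> round_measurable T.+1.
Proof.
move=> mr mx mz; have mo := finite_measurable_outcome T.+1 mr.
split; first exact: mo.
move=> j; have mp := measurable_price T.+1 j mr.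
have mw : measurable_fun setT (fun w => rd_reward (rec T.+1 w) j).
  apply: (measurable_fun_finite (f := fun o w => x j T.+1 (alloc pb j o) w)) => //.
split => //; rewrite /rec /round_of /=.
have := st_valid j; case: (st j) => [b _|f /= vf] //.
(* [valid_strategy] gives measurability for each fixed sequence of allocations; there are finitely
   many of these for a given [T], and the pieces are glued. *)
pose u w := ([tuple alloc pb j (rd_outcome (rec k.+1 w)) | k < T],
             alloc pb j (outcome_at im sigma est st T.+1 (hist T w))).
have mu : finite_measurable u.
  apply: finite_measurable_pair; last exact: finite_measurable_comp mo.
  rewrite (_ : (fun w => _) = fun w => (fun c : {ffun 'I_T -> S} => [tuple c k | k < T])
     [ffun k : 'I_T => alloc pb j (rd_outcome (rec k.+1 w))]); last first.
    by apply/funext => w; apply: eq_from_tnth => k; rewrite !tnth_mktuple ffunE.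
  apply: (finite_measurable_comp (fun c : {ffun 'I_T -> S} => [tuple c k | k < T])).
  apply: finite_measurable_ffun => k; apply: (finite_measurable_comp (alloc pb j)).
  by have [] := mr k.+1 (ltn_ord k).
pose tup w : T.-tuple (measurableTypeR R * measurableTypeR R * measurableTypeR R) :=
  [tuple (rd_price (rec k.+1 w) j, rd_reward (rec k.+1 w) j,
              rd_report (rec k.+1 w) j) | k < T].
pose cur w : measurableTypeR R * measurableTypeR R * measurableTypeR R :=
  (rd_price (rec T.+1 w) j, rd_reward (rec T.+1 w) j, z j T.+1 w).
rewrite (_ : (fun w => _) = fun w => f (zip (u w).1 (tup w)) (u w).2 (cur w));
  last by apply/funext => w; rewrite past_of_hist.
apply: (measurable_fun_finite (T := measurableTypeR R)
  (f := fun (a : T.-tuple S * S) w => f (zip a.1 (tup w)) a.2 (cur w)) mu) => a.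
apply: (measurableT_comp (vf T a.1 a.2) (g := fun w => (tup w, cur w))).
apply: measurable_fun_pair.
  apply/measurable_fun_tnthP => k.
  rewrite (_ : _ \o _ = fun w => (rd_price (rec k.+1 w) j, rd_reward (rec k.+1 w) j,
              rd_report (rec k.+1 w) j)); last first.
    by apply/funext => w /=; rewrite tnth_mktuple.
  have [_ /(_ j)[? ? ?]] := mr k.+1 (ltn_ord k).
  by do 2 apply: measurable_fun_pair => //.
by apply: measurable_fun_pair; [exact: measurable_fun_pair|exact: mz].
Qed.

Lemma rounds_measurable T :
  (forall j t s, (0 < t <= T)%N -> measurable_fun setT (x j t s)) ->
  (forall j t, (0 < t <= T)%N -> measurable_fun setT (z j t)) ->
  forall t, (0 < t <= T)%N -> round_measurable t.
Proof.
elim: T => [|T IH] mx mz t; first by lia.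
have {}IH t' : (0 < t' <= T)%N -> round_measurable t'.
  by apply: IH => [j r s r1|j r r1]; [apply: mx|apply: mz]; lia.
move=> /andP[t0]; rewrite leq_eqVlt => /orP[/eqP ->|tT]; last by apply: IH; lia.
by apply: round_measurable_succ => // [j s|j]; [apply: mx|apply: mz]; lia.
Qed.

End HistoryMeasurable.

(** * Deviation of adaptively sampled means *)

Section ExpProcess.
Context {R : realType} {n : nat} {Omega S : finType}.
Variables (pb : @problem R n Omega S) (im : implementation pb) (sigma : R).

Definition exp_process est j s (m l : R) (h : seq (@round_record R n Omega)) : R :=
  expR (l * (\sum_(r <- h | used im est j s r) (rd_report r j - m)) -
        l ^+ 2 * sigma ^+ 2 / 2 * (sample_count im est h j s)%:R).

Lemma exp_process_nil est j s m l : exp_process est j s m l [::] = 1.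
Proof. by rewrite /exp_process big_nil /sample_count /= !mulr0 subr0 expR0. Qed.

Lemma exp_process_rcons est j s m l h r :
  exp_process est j s m l (rcons h r) = exp_process est j s m l h *
  (if used im est j s r then expR (l * (rd_report r j - m) - l ^+ 2 * sigma ^+ 2 / 2)
   else 1).
Proof.
rewrite /exp_process /sample_count -cats1 big_cat count_cat /= big_cons big_nil.
case: (used im est j s r); rewrite /= ?addr0 ?addn0 ?mulr1 //.
by rewrite -expRD natrD; congr expR; ring.
Qed.

Lemma measurable_exp_process est pr st d (W : measurableType d)
    (x : 'I_n -> nat -> S -> W -> R) (z : 'I_n -> nat -> W -> R) j s m l T :
  (forall t, (0 < t <= T)%N -> round_measurable im sigma est pr st x z t) ->
  measurable_fun setT (fun w => exp_process est j s m l
    (history im sigma est pr st (fun i t s => x i t s w) (fun i t => z i t w) T)).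
Proof.
move=> mr; apply: (measurableT_comp (@measurable_expR R)).
apply: measurable_funB; apply: measurable_funM => //.
  exact: measurable_report_sum.
exact: (measurable_fun_discr (fun N => N%:R : R) (measurable_sample_count j s mr)).
Qed.

(** The compensator [l^2 * sigma^2 / 2] cancels the sub-Gaussian bound exactly, so a factor of the
    exponential process has mean at most 1. *)
Lemma sub_gaussian_sampled d (W : measurableType d) (P : probability W R)
    (D : probability (measurableTypeR R) R) (m : R) (Y : W -> R) (l : R) :
  measurable_fun setT Y -> sampled_from P Y D -> sub_gaussian sigma m D ->
  (\int[P]_w (expR (l * (Y w - m) - l ^+ 2 * sigma ^+ 2 / 2))%:E <= 1%:E)%E.
Proof.
move=> mY YD [_ /(_ l) sg].
pose Y' : {RV P >-> measurableTypeR R} :=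
  HB.pack (Y : W -> measurableTypeR R) (isMeasurableFun.Build _ _ _ (measurableTypeR R) Y mY).
pose c := l ^+ 2 * sigma ^+ 2 / 2.
have mh : measurable_fun [set: measurableTypeR R]
    (fun y : measurableTypeR R => (expR (l * (y - m)))%:E).
  apply/measurable_EFinP; apply: (measurableT_comp (@measurable_expR R)).
  by apply: measurable_funM => //; apply: measurable_funB.
have -> : (\int[P]_w (expR (l * (Y w - m) - l ^+ 2 * sigma ^+ 2 / 2))%:E =
    (expR (- c))%:E * \int[D]_y (expR (l * (y - m)))%:E)%E.
  transitivity ((expR (- c))%:E * \int[P]_w (expR (l * (Y w - m)))%:E)%E.
    rewrite -ge0_integralZl ?lee_fin ?expR_ge0 //; last first.
      by apply: (measurableT_comp mh).
    by apply: eq_integral => w _; rewrite -EFinM -expRD addrC.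
  congr (_ * _)%E.
  rewrite -[LHS](@ge0_integral_distribution _ _ _ _ _ P Y'
    (fun y => (expR (l * (y - m)))%:E)) //.
  by apply: eq_measure_integral => A mA _; exact: YD.
move: sg; rewrite unlock => sg.
apply: (@le_trans _ _ ((expR (- c))%:E * (expR (sigma ^+ 2 * l ^+ 2 / 2))%:E)%E).
  by apply: lee_wpmul2l => //; rewrite lee_fin expR_ge0.
rewrite -EFinM -expRD lee_fin (_ : _ + _ = 0) ?expR0 //.
by rewrite /c; ring.
Qed.

End ExpProcess.

Section Supermartingale.
Context {R : realType} {n : nat} {Omega S : finType}.
Variables (pb : @problem R n Omega S) (im : implementation pb) (sigma : R).
Context d (W : measurableType d) (P : probability W R).
Variables (X : 'I_n -> nat -> S -> {RV P >-> R}) (xi : 'I_n -> nat -> {RV P >-> R}).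
Hypothesis X_xi_independent : independent_family P (primitive X xi).

Local Notation Z := (primitive X xi).

Definition primitive_round (k : ('I_n * nat * S) + ('I_n * nat)) : nat :=
  match k with inl (_, t, _) => t | inr (_, t) => t end.

Lemma measurable_primitive k : measurable_fun setT (Z k).
Proof. by case: k => [[[i t] s]|[i t]]; exact: measurable_funPT. Qed.

Lemma measurable_primitive_sigma (Q : pred ('I_n * nat * S + 'I_n * nat)) k :
  Q k -> measurable_fun [set: g_sigma_algebraType (cylinder Z Q)] (Z k).
Proof.
move=> Qk _ B mB; rewrite setTI; apply: sub_sigma_algebra.
exists [:: k], (fun=> B); split => //; first by rewrite /= Qk.
apply/seteqP; split => w /=; first by move=> Bw k'; rewrite inE => /eqP ->.
by apply; rewrite inE.
Qed.

Definition past_upto T : pred ('I_n * nat * S + 'I_n * nat) :=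
  fun k => (primitive_round k <= T)%N.
Definition at_round T : pred ('I_n * nat * S + 'I_n * nat) :=
  fun k => primitive_round k == T.

Variables (est : estimation) (pr : pricing) (st : 'I_n -> @strategy R S).
Hypothesis st_valid : forall j, valid_strategy (st j).

Lemma rounds_measurable_past T t : (0 < t <= T)%N ->
  @round_measurable R n Omega S pb im sigma est pr st _
    (g_sigma_algebraType (cylinder Z (past_upto T))) X xi t.
Proof.
apply: rounds_measurable => // [j r s /andP[_ rT]|j r /andP[_ rT]].
  exact: (@measurable_primitive_sigma (past_upto T) (inl (j, r, s))).
exact: (@measurable_primitive_sigma (past_upto T) (inr (j, r))).
Qed.

Lemma rounds_measurable_run t : (0 < t)%N ->
  round_measurable im sigma est pr st X xi t.
Proof.
move=> t0; apply: (@rounds_measurable _ _ _ _ _ _ _ _ _ _ _ _ _ _ _ t) => //.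
by rewrite t0 /=.
Qed.

Variables (j : 'I_n) (f : seq (@observation R S) -> S -> R * R * R -> R).
Variables (Q : S -> probability (measurableTypeR R) R) (g : S -> R -> R -> R).
Hypothesis stj : st j = Reports f.
Hypothesis fg : forall past s p x z, f past s (p, x, z) = g s x z.

Lemma measurable_stationary_report d' (W' : measurableType d') s (x z : W' -> R) :
  measurable_fun setT x -> measurable_fun setT z ->
  measurable_fun setT (fun w => g s (x w) (z w)).
Proof.
move=> mx mz; have := st_valid j; rewrite stj /= => /(_ 0%N [tuple] s) vf.
(* Measurability is known for [f], which ignores past and price; an empty past and price 0 transfer
   it to [g s]. *)
pose cur w : 0.-tuple (measurableTypeR R * measurableTypeR R * measurableTypeR R) *
  (measurableTypeR R * measurableTypeR R * measurableTypeR R) :=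
  ([tuple], (0 : measurableTypeR R, x w, z w)).
rewrite (_ : (fun w => _) = fun w => f (zip [tuple] (cur w).1) s (cur w).2); last first.
  by apply/funext => w; rewrite /= fg.
apply: (measurableT_comp vf (g := cur)).
apply: measurable_fun_pair => //.
by apply: measurable_fun_pair => //; exact: measurable_fun_pair.
Qed.

Hypothesis sampled : forall t s, sampled_from P (fun w => g s (X j t s w) (xi j t w)) (Q s).
Variables (s : S) (m : R).
Hypothesis subg : sub_gaussian sigma m (Q s).

Local Notation run := (run X xi im sigma est pr st).

Lemma used_report T w :
  let r := round_of im sigma est pr st (fun i t s => X i t s w) (fun i t => xi i t w) T in
  used im est j s r -> rd_report r j = g s (X j T s w) (xi j T w).
Proof. by move=> r /andP[/eqP ra _]; rewrite /r /= stj fg -ra. Qed.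

Lemma exp_process_supermartingale l T :
  (\int[P]_w (exp_process im sigma est j s m l (run T w))%:E <= 1%:E)%E.
Proof.
pose rec t w := round_of im sigma est pr st (fun i t s => X i t s w) (fun i t => xi i t w) t.
elim: T => [|T IH].
  under eq_integral => w _ do rewrite exp_process_nil.
  by rewrite integral_cst //= probability_setT mule1.
pose M w := exp_process im sigma est j s m l (run T w).
pose u w := used im est j s (rec T.+1 w).
pose Y w := g s (X j T.+1 s w) (xi j T.+1 w).
pose h w := expR (l * (Y w - m) - l ^+ 2 * sigma ^+ 2 / 2).
have M0 w : 0 <= M w by exact: expR_ge0.
have h0 w : 0 <= h w by exact: expR_ge0.
have ME w : exp_process im sigma est j s m l (run T.+1 w) =
    M w * (~~ u w)%:R + (M w * (u w)%:R) * h w.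
  rewrite [run T.+1 w]/= exp_process_rcons -/(M w) -/(rec T.+1 w) -/(u w) /h /Y.
  have : u w -> rd_report (rec T.+1 w) j = Y w by exact: (@used_report T.+1 w).
  by case: (u w) => [/(_ isT) ->|_]; rewrite ?mulr1 ?mulr0 ?add0r ?mul0r ?addr0.
have mM : measurable_fun [set: g_sigma_algebraType (cylinder Z (past_upto T))] M.
  by apply: measurable_exp_process => t; exact: rounds_measurable_past.
have mo := finite_measurable_outcome T.+1 (@rounds_measurable_past T).
have mu : @finite_measurable _ (g_sigma_algebraType (cylinder Z (past_upto T))) bool u.
  exact: (finite_measurable_comp (fun o => used im est j s
    (RoundRecord T.+1 o (fun=> 0 : R) (fun=> 0) (fun=> 0))) mo).
have mMu : measurable_fun [set: g_sigma_algebraType (cylinder Z (past_upto T))]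
    (fun w => M w * (u w)%:R).
  apply: measurable_funM => //.
  exact: (measurable_fun_finite (f := fun (b : bool) _ => b%:R : R) mu).
have mMnu : measurable_fun [set: g_sigma_algebraType (cylinder Z (past_upto T))]
    (fun w => M w * (~~ u w)%:R).
  apply: measurable_funM => //.
  exact: (measurable_fun_finite (f := fun (b : bool) _ => (~~ b)%:R : R) mu).
have mh : measurable_fun [set: g_sigma_algebraType (cylinder Z (at_round T.+1))] h.
  apply: (measurableT_comp (@measurable_expR R)).
  apply: measurable_funB => //; apply: measurable_funM => //; apply: measurable_funB => //.
  apply: measurable_stationary_report.
    by apply: (@measurable_primitive_sigma (at_round T.+1) (inl (j, T.+1, s))); exact: eqxx.
  by apply: (@measurable_primitive_sigma (at_round T.+1) (inr (j, T.+1))); exact: eqxx.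
have sW (Q' : pred _) (k : W -> R) :
    measurable_fun [set: g_sigma_algebraType (cylinder Z Q')] k -> measurable_fun [set: W] k.
  move=> mk _ B mB; rewrite setTI; apply: (sigma_cylinder_measurable measurable_primitive).
  by have := mk measurableT B mB; rewrite setTI; exact.
have mWMu := sW _ _ mMu; have mWMnu := sW _ _ mMnu; have mWh := sW _ _ mh.
under eq_integral => w _ do rewrite ME EFinD.
rewrite ge0_integralD //=; first last.
- by apply/measurable_EFinP; exact: measurable_funM.
- by move=> w _; rewrite lee_fin !mulr_ge0.
- exact/measurable_EFinP.
- by move=> w _; rewrite lee_fin mulr_ge0.
rewrite (expectation_prod_sigma measurable_primitive X_xi_independent _ mMu mh) //;
  first last.
- by move=> w; rewrite mulr_ge0.
- by move=> k; rewrite /past_upto /at_round => kT; rewrite neq_ltn ltnS kT.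
apply: le_trans IH.
have Eh : (\int[P]_w (h w)%:E <= 1%:E)%E.
  apply: sub_gaussian_sampled (sampled T.+1 s) subg.
  by apply: measurable_stationary_report; exact: measurable_funPT.
have -> : (\int[P]_w (exp_process im sigma est j s m l (run T w))%:E =
    \int[P]_w (M w * (~~ u w)%:R)%:E + \int[P]_w (M w * (u w)%:R)%:E)%E.
  rewrite -ge0_integralD //=.
  - apply: eq_integral => w _; rewrite -EFinD -/(M w).
    by case: (u w); rewrite /= ?mulr0 ?mulr1 ?addr0 ?add0r.
  - by move=> w _; rewrite lee_fin mulr_ge0.
  - exact/measurable_EFinP.
  - by move=> w _; rewrite lee_fin mulr_ge0.
  - exact/measurable_EFinP.
rewrite leeD2l // -[leRHS]mule1; apply: lee_wpmul2l => //.
by apply: integral_ge0 => w _; rewrite lee_fin mulr_ge0.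
Qed.

(** At [sigma = 0] the parameters 1 and -1 give that [exp(Y-m) + exp(m-Y) - 2], which is
    nonnegative, has integral at most 0. So it vanishes almost surely, and strict convexity forces
    [Y = m]. *)
Lemma noiseless_report : sigma = 0 ->
  {ae P, forall w, forall t, g s (X j t s w) (xi j t w) = m}.
Proof.
move=> sigma0; apply: ae_foralln => t.
pose Y w := g s (X j t s w) (xi j t w).
have mY : measurable_fun setT Y.
  by apply: measurable_stationary_report; exact: measurable_funPT.
pose c w := expR (Y w - m) + expR (m - Y w) - 2.
have ineq (y : R) : 0 <= expR y + expR (- y) - 2.
  have := expR_ge1Dx y; have := expR_ge1Dx (- y); lra.
have c0 w : 0 <= c w by rewrite /c -[m - Y w]opprB.
have me (k : R) : measurable_fun setT (fun w => expR (k * (Y w - m))).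
  apply: (measurableT_comp (@measurable_expR R)).
  by apply: measurable_funM => //; exact: measurable_funB.
have mc : measurable_fun setT c.
  rewrite (_ : c = fun w => expR (1 * (Y w - m)) + expR (-1 * (Y w - m)) - 2).
    by apply: measurable_funB => //; exact: measurable_funD.
  by apply/funext => w; rewrite /c mul1r mulN1r opprB.
have e1 k : (\int[P]_w (expR (k * (Y w - m)))%:E <= 1%:E)%E.
  have := @sub_gaussian_sampled R sigma _ W P (Q s) m Y k mY (sampled t s) subg.
  apply: le_trans; rewrite le_eqVlt; apply/orP; left; apply/eqP.
  by apply: eq_integral => w _; rewrite sigma0 expr0n /= mulr0 mul0r subr0.
have ic : (\int[P]_w (c w)%:E = 0)%E.
  have h : (\int[P]_w (c w)%:E + 2%:E <= 2%:E)%E.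
    have <- : (\int[P]_w cst 2%:E w = 2%:E :> \bar R)%E.
      by rewrite integral_cst //= probability_setT mule1.
    rewrite -ge0_integralD //=; last 2 first.
    - by move=> w _; rewrite lee_fin.
    - exact/measurable_EFinP.
    apply: (@le_trans _ _ (\int[P]_w (expR (1 * (Y w - m)))%:E +
       \int[P]_w (expR (-1 * (Y w - m)))%:E)%E); last first.
      rewrite integral_cst //= probability_setT mule1 (_ : 2%:E = 1%:E + 1%:E)%E //.
      exact: leeD.
    rewrite -ge0_integralD //; try exact/measurable_EFinP;
      try by move=> w _; rewrite lee_fin expR_ge0.
    rewrite le_eqVlt; apply/orP; left; apply/eqP; apply: eq_integral => w _.
    by rewrite -!EFinD /c mul1r mulN1r opprB subrK.
  apply/eqP; rewrite eq_le integral_ge0 ?andbT; last by move=> w _; rewrite lee_fin.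
  by move: h; rewrite -{2}[2%:E]add0e leeD2rE.
have : ae_eq P setT (EFin \o c) (cst 0%E).
  apply/(ae_eq_integral_abs P measurableT _).1; first exact/measurable_EFinP.
  rewrite -[RHS]ic; apply: eq_integral => w _ /=.
  by rewrite ger0_norm.
apply: filterS => w /(_ I) /= [cw].
have yge := expR_ge1Dx (Y w - m); have yge' := expR_ge1Dx (m - Y w).
apply/eqP; rewrite -subr_eq0 -/(Y w); apply/negPn/negP => y0.
have := expR_gt1Dx y0; rewrite /c in cw; lra.
Qed.

End Supermartingale.

(** * Clipping and the Chernoff exponent *)

Section Clip.
Context {R : realType}.

Definition clip01 (x : R) : R := Num.max 0 (Num.min 1 x).

Lemma clip01_id x : 0 <= x <= 1 -> clip01 x = x.
Proof. by move=> /andP[x0 x1]; rewrite /clip01 min_r // max_r. Qed.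

Lemma clip01_cases x : [\/ x <= 0 /\ clip01 x = 0, 0 <= x <= 1 /\ clip01 x = x |
  1 <= x /\ clip01 x = 1].
Proof.
have [x0|x0] := leP x 0.
  by constructor 1; rewrite /clip01 max_l // ge_min x0 orbT.
have [x1|x1] := leP 1 x.
  by constructor 3; rewrite /clip01 min_l // max_r.
by constructor 2; rewrite clip01_id ?(ltW x0) ?(ltW x1).
Qed.

Lemma clip01_dist x y : `|clip01 x - clip01 y| <= `|x - y|.
Proof.
rewrite ler_norml; move: (ler_norm (x - y)) (ler_norm (y - x)).
rewrite (distrC y x); set a := `|x - y| => h1 h2.
have a0 : 0 <= a by exact: normr_ge0.
by case: (clip01_cases x) => [] [hx ->]; case: (clip01_cases y) => [] [hy ->]; lra.
Qed.

(* Chernoff: the exponent [l * D - l ^+ 2 * sigma ^+ 2 / 2 * k] is maximal at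
   [l = D / (k * sigma ^+ 2)]; at [D = k * c * sigma * sqrt (L / k)] this is the
   [l] below and the maximum is [c ^+ 2 * L / 2] *)
Lemma chernoff_witness (sigma k L c D m : R) :
  0 < sigma -> 0 < k -> 0 <= L -> 0 < c ->
  let l := c * Num.sqrt (L / k) / sigma in
  let M l := expR (l * D - l ^+ 2 * sigma ^+ 2 / 2 * k) in
  c * (sigma * Num.sqrt (L / k)) < `|clip01 (m + D / k) - clip01 m| ->
  1 <= expR (- (c ^+ 2 * L / 2)) * (M l + M (- l)).
Proof.
move=> s0 k0 L0 c0 l M dev.
have {}dev : c * (sigma * Num.sqrt (L / k)) < `|D| / k.
  apply: lt_le_trans dev _; apply: le_trans (clip01_dist _ _) _.
  by rewrite addrAC subrr add0r normrM (ger0_norm (x := k^-1)) // invr_ge0 ltW.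
set y := Num.sqrt (L / k) in l M dev *.
have y0 : 0 <= y by exact: sqrtr_ge0.
have yL : y ^+ 2 * k = L by rewrite sqr_sqrtr ?divr_ge0 ?(ltW k0) // divfK // gt_eqF.
have l0 : 0 <= l by rewrite divr_ge0 ?mulr_ge0 // ltW.
have ls : l * sigma = c * y by rewrite divfK // gt_eqF.
clearbody l y.
have lD : c ^+ 2 * L <= l * `|D|.
  have -> : c ^+ 2 * L = l * (c * (sigma * y) * k).
    by rewrite -yL (_ : l * _ = (l * sigma) * (c * y * k)); [rewrite ls|]; ring.
  by rewrite ler_wpM2l // -ler_pdivlMr // ltW.
have lk : l ^+ 2 * sigma ^+ 2 / 2 * k = c ^+ 2 * L / 2.
  by rewrite -exprMn ls exprMn -yL; ring.
have big : 1 <= expR (- (c ^+ 2 * L / 2)) * expR (l * `|D| - c ^+ 2 * L / 2).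
  by rewrite -expRD -[leLHS]expR0 ler_expR; lra.
apply: le_trans big _; rewrite ler_wpM2l ?expR_ge0 // /M sqrrN lk.
case: (lerP 0 D) => D0; first by rewrite (ger0_norm D0) lerDl expR_ge0.
by rewrite (ltr0_norm D0) mulrN -mulNr lerDr expR_ge0.
Qed.

End Clip.

(** * Sample counts and widths along a run *)

Section Runs.
Context {R : realType} {n : nat} {Omega S : finType}.
Variables (pb : @problem R n Omega S) (im : implementation pb) (sigma : R).
Hypothesis sigma_ge0 : 0 <= sigma.
Local Notation K := (phase_length im).
Variables (est : estimation) (pr : pricing) (st : 'I_n -> @strategy R S).
Variables (x : 'I_n -> nat -> S -> R) (z : 'I_n -> nat -> R) (i0 : 'I_n).
Local Notation rec := (round_of im sigma est pr st x z).
Local Notation hist := (history im sigma est pr st x z).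

Lemma total_utility_history i T : total_utility pb i (hist T) =
  \sum_(1 <= t < T.+1) (if exploring im t
    then value pb i (alloc pb i (explore_seq im (position im t)))
    else round_utility im sigma est pr st t (hist t.-1) i).
Proof.
rewrite /total_utility history_map big_map /index_iota subSS subn0.
apply: eq_bigr => t _; rewrite /rec /= /outcome_at /price_at.
by case: ifP; rewrite ?subr0.
Qed.

(** In an explore phase [used_atP] makes the allocation test automatic, so which explore rounds are
    used is not random. *)
Lemma used_round j s t : used im est j s (rec t) =
  if exploring im t then used_at im (bracket im t) j s == position im t
  else if est is OPT then alloc pb j (rd_outcome (rec t)) == s else false.
Proof.
rewrite /used /= /outcome_at; case: ifP => _; last by case: (est); rewrite ?andbT ?andbF.
by rewrite andbC; case: eqP => //= <-; rewrite used_atP eqxx.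
Qed.

Lemma sample_count_hist j s T : sample_count im est (hist T) j s =
  count (fun t => used im est j s (rec t)) (iota 1 T).
Proof. by rewrite /sample_count history_map count_map. Qed.

Lemma sample_count_ge j s t : (0 < t)%N -> ~~ exploring im t ->
  (bracket im t <= sample_count im est (hist t.-1) j s)%N.
Proof.
move=> t0 ex; rewrite sample_count_hist -(used_explore_count_exploit i0 j s t0 ex).
by apply: sub_count => r /andP[exr u]; rewrite used_round exr.
Qed.

(** Besides one report per explore phase, each earlier exploit round adds at most one sample. The
    inequality is strict because [exploit_count im t] includes round [t] itself. *)
Lemma sample_count_lt j s t : (0 < t)%N -> ~~ exploring im t ->
  (sample_count im est (hist t.-1) j s < bracket im t + exploit_count im t)%N.
Proof.
move=> t0 ex; rewrite sample_count_hist -(used_explore_count_exploit i0 j s t0 ex).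
case: t t0 ex => // t _ ex; rewrite /= exploit_countS ex addn1 addnS ltnS.
rewrite /exploit_count -count_predUI; apply: leq_trans (leq_addr _ _).
by apply: sub_count => r; rewrite /= used_round; case: (exploring im r); rewrite ?orbT ?orbF.
Qed.

Lemma log_factorE t : (0 < t)%N -> ~~ exploring im t ->
  5 * ln (t%:R - (bracket im t * K)%:R + 1) + 2 * ln #|S|%:R = log_factor im t.
Proof.
move=> t0 ex; rewrite /log_factor {1}(exploit_round_decomp i0 t0 ex) natrD addrK.
by rewrite natr1.
Qed.

Lemma spread_range j s t : (0 < t)%N -> ~~ exploring im t ->
  0 <= spread im sigma est st t (hist t.-1) j s <= radius im sigma t.
Proof.
move=> t0 ex; rewrite ge0_spread //= /spread.
case: (st j) => [_|_]; first exact: ge0_radius.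
rewrite /width log_factorE // ler_wpM2l // ler_sqrt; last first.
  by rewrite divr_ge0 // ge0_log_factor // (card_alloc_gt0 im i0).
have [b0 _ _] := round_state im i0 t0; have bN := sample_count_ge j s t0 ex.
rewrite ler_wpM2l ?ge0_log_factor ?(card_alloc_gt0 im i0) // lef_pV2 ?posrE ?ltr0n //.
- by rewrite ler_nat.
- exact: leq_trans b0 bN.
Qed.

End Runs.

Section EtcRuns.
Context {R : realType} {n : nat} {Omega S : finType}.
Variables (pb : @problem R n Omega S) (im : implementation pb) (sigma : R).
Variables (pr : pricing) (st : 'I_n -> @strategy R S).
Variables (x : 'I_n -> nat -> S -> R) (z : 'I_n -> nat -> R) (i0 : 'I_n).
Local Notation hist := (history im sigma ETC pr st x z).

Lemma used_round_ETC j s t : used im ETC j s (round_of im sigma ETC pr st x z t) =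
  exploring im t && (used_at im (bracket im t) j s == position im t).
Proof. by rewrite used_round; case: (exploring im t). Qed.

Lemma sample_count_ETC j s t : (0 < t)%N -> ~~ exploring im t ->
  sample_count im ETC (hist t.-1) j s = bracket im t.
Proof.
move=> t0 ex; rewrite sample_count_hist -(used_explore_count_exploit i0 j s t0 ex).
by apply: eq_count => r; exact: used_round_ETC.
Qed.

Lemma spread_ETC j s t : (0 < t)%N -> ~~ exploring im t ->
  spread im sigma ETC st t (hist t.-1) j s =
  if by_bids (st j) then 0 else radius im sigma t.
Proof.
move=> t0 ex; rewrite /spread /width sample_count_ETC // (log_factorE i0) //.
by case: (st j).
Qed.

End EtcRuns.

(** Only explore-phase reports enter the average, which is precisely what [same_behaviour]
    controls. *)
Lemma clipped_mean_ETC {R : realType} {n : nat} {Omega S : finType}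
    (pb : @problem R n Omega S) (im : implementation pb) sigma pr st st' x z j s T :
  (forall t, (0 < t <= T)%N -> exploring im t ->
    rd_report (round_of im sigma ETC pr st x z t) j =
    rd_report (round_of im sigma ETC pr st' x z t) j) ->
  clipped_mean im ETC (history im sigma ETC pr st x z T) j s =
  clipped_mean im ETC (history im sigma ETC pr st' x z T) j s.
Proof.
move=> same; rewrite /clipped_mean !sample_count_hist.
rewrite (eq_count (fun t => used_round_ETC im sigma pr st x z j s t)).
rewrite (eq_count (fun t => used_round_ETC im sigma pr st' x z j s t)).
congr (Num.max 0 (Num.min 1 (_ / _))).
rewrite !history_map !big_map big_seq_cond [RHS]big_seq_cond.
apply: eq_big => [t|t /andP[tT]]; first by rewrite !used_round_ETC.
rewrite used_round_ETC => /andP[ext _]; apply: same => //.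
by move: tT; rewrite mem_iota; lia.
Qed.

(** * Tail bounds for the estimates *)

Section Tail.
Context {R : realType} {n : nat} {Omega S : finType}.
Variables (pb : @problem R n Omega S) (im : implementation pb) (sigma : R).
Hypothesis sigma_ge0 : 0 <= sigma.
Context d (W : measurableType d) (P : probability W R).
Variables (X : 'I_n -> nat -> S -> {RV P >-> R}) (xi : 'I_n -> nat -> {RV P >-> R}).
Hypothesis X_xi_independent : independent_family P (primitive X xi).
Variables (est : estimation) (pr : pricing) (st : 'I_n -> @strategy R S).
Hypothesis st_valid : forall j, valid_strategy (st j).
Local Notation run := (run X xi im sigma est pr st).

Definition tail_rate (c : R) k t : R :=
  c * Num.sqrt (log_factor im t / k%:R) / sigma.

(** A pointwise form of Markov's inequality: at the actual number of samples [k] it is at least 1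
    when the deviation exceeds [c] widths. The two signs of the parameter cover the two tails. *)
Definition tail_bound (c : R) k t j s m w : R :=
  expR (- (c ^+ 2 * log_factor im t / 2)) *
  (exp_process im sigma est j s m (tail_rate c k t) (run t.-1 w) +
   exp_process im sigma est j s m (- tail_rate c k t) (run t.-1 w)).

Lemma ge0_tail_bound c k t j s m w : 0 <= tail_bound c k t j s m w.
Proof. by rewrite mulr_ge0 ?addr_ge0 ?expR_ge0. Qed.

Lemma measurable_tail_bound c k t j s m :
  measurable_fun setT (tail_bound c k t j s m).
Proof.
apply: measurable_funM => //; apply: measurable_funD;
  by apply: measurable_exp_process => t' /andP[? _]; exact: rounds_measurable_run.
Qed.

Variables (j : 'I_n) (f : seq (@observation R S) -> S -> R * R * R -> R).
Variables (Q : S -> probability (measurableTypeR R) R) (g : S -> R -> R -> R).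
Hypothesis stj : st j = Reports f.
Hypothesis fg : forall past s p x z, f past s (p, x, z) = g s x z.
Hypothesis sampled : forall t s, sampled_from P (fun w => g s (X j t s w) (xi j t w)) (Q s).
Variables (s : S) (m : R).
Hypothesis subg : sub_gaussian sigma m (Q s).

Lemma integral_tail_bound c k t :
  (\int[P]_w (tail_bound c k t j s m w)%:E <=
     (2 * expR (- (c ^+ 2 * log_factor im t / 2)))%:E)%E.
Proof.
have E l := exp_process_supermartingale im X_xi_independent est pr st_valid stj
  fg sampled subg l t.-1.
have mE l : measurable_fun setT (fun w => exp_process im sigma est j s m l (run t.-1 w)).
  by apply: measurable_exp_process => t' /andP[? _]; exact: rounds_measurable_run.
rewrite /tail_bound; under eq_integral => w _ do rewrite EFinM EFinD.
rewrite ge0_integralZl ?lee_fin ?expR_ge0 //; last 2 first.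
- by apply: emeasurable_funD; apply/measurable_EFinP.
- by move=> w _; rewrite -EFinD lee_fin addr_ge0 ?expR_ge0.
rewrite ge0_integralD //; try (by move=> w _; rewrite lee_fin expR_ge0);
  try (by apply/measurable_EFinP).
rewrite [X in (_ <= X%:E)%E]mulrC EFinM; apply: lee_wpmul2l; first by rewrite lee_fin expR_ge0.
by rewrite (_ : 2%:E = 1%:E + 1%:E)%E //; apply: leeD; exact: E.
Qed.

(** For [sigma > 0] this is the Chernoff bound and holds for every [w]. For [sigma = 0] the width is
    0, so the estimate has to be exact, which is true almost surely. *)
Lemma tail_bound_ae c : 0 < c ->
  {ae P, forall w, forall t, (0 < t)%N -> ~~ exploring im t ->
    `|center im est st (run t.-1 w) j s - clip01 m| <=
       c * spread im sigma est st t (run t.-1 w) j s \/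
    1 <= tail_bound c (sample_count im est (run t.-1 w) j s) t j s m w}.
Proof.
move=> c0.
(* Centring the reports at [m] requires a positive sample count; it holds since each explore phase
   supplies a sample. *)
have cE t w : (0 < t)%N -> ~~ exploring im t ->
    center im est st (run t.-1 w) j s = clip01 (m +
      (\sum_(r <- run t.-1 w | used im est j s r) (rd_report r j - m)) /
        (sample_count im est (run t.-1 w) j s)%:R).
  move=> t0 ex; rewrite /center stj /clipped_mean -/(clip01 _); congr clip01.
  have N0 : (0 < sample_count im est (run t.-1 w) j s)%N.
    have [b0 _ _] := round_state im j t0.
    exact: leq_trans b0 (sample_count_ge _ _ _ _ _ _ j j s t0 ex).
  rewrite sumrB mulrBl big_const_seq -/(sample_count im est _ j s) iter_addr_0.
  by rewrite -(mulr_natr m) mulfK ?pnatr_eq0 -?lt0n // addrC subrK.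
have [sigma0|sigma_neq0] := eqVneq sigma 0.
  have := noiseless_report st_valid stj fg sampled subg sigma0.
  apply: filterS => w noiseless t t0 ex; left.
  have D0 : \sum_(r <- run t.-1 w | used im est j s r) (rd_report r j - m) = 0.
    rewrite /run history_map big_map; apply: big1 => t' /(used_report stj fg) ->.
    by rewrite noiseless subrr.
  by rewrite cE // D0 mul0r addr0 subrr normr0 mulr_ge0 ?ge0_spread // ltW.
apply: aeW => w t t0 ex; set h := run t.-1 w; set N := sample_count _ _ _ _ _.
have N0 : 0 < N%:R :> R.
  have [b0 _ _] := round_state im j t0; rewrite ltr0n.
  exact: leq_trans b0 (sample_count_ge _ _ _ _ _ _ j j s t0 ex).
case: lerP => dev; [by left|right].
have s0 : 0 < sigma by rewrite lt_neqAle eq_sym sigma_neq0.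
rewrite cE // -/h -/N /spread stj /width -/N (log_factorE j) // in dev.
have L0 : 0 <= log_factor im t by rewrite ge0_log_factor // (card_alloc_gt0 im j).
exact: (chernoff_witness s0 N0 L0 c0 dev).
Qed.

End Tail.

(** * Summation of the per-round bounds *)

Section ExpectationBound.
Context {R : realType} d (W : measurableType d) (P : probability W R).
Local Open Scope ereal_scope.

(* [f] is not assumed measurable: the integral of its positive part is still
   the supremum over the simple functions below it *)
Lemma expectation_le_ae (f B : W -> R) :
  measurable_fun setT B -> (forall w, 0 <= B w)%R ->
  {ae P, forall w, (f w <= B w)%R} -> 'E_P[f] <= \int[P]_w (B w)%:E.
Proof.
move=> mB B0 [N [mN PN fB]]; rewrite unlock integralE.
apply: (@le_trans _ _ (\int[P]_w ((fun w => (f w)%:E) ^\+ w))).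
  by rewrite geeDl // oppe_le0; exact: integral_ge0.
(* Raising the bound to infinity on the null set makes the domination hold everywhere without
   changing the integral. *)
pose B' w := if w \in N then +oo else (B w)%:E.
have B'0 w : 0 <= B' w by rewrite /B'; case: ifP => // _; rewrite lee_fin.
have mB' : measurable_fun setT B'.
  apply: measurable_fun_ifT => //; last exact/measurable_EFinP.
  apply: (measurable_fun_bool true); rewrite setTI.
  rewrite (_ : _ @^-1` _ = N) //.
  by apply/seteqP; split => w /=; [exact: set_mem|exact: mem_set].
have -> : \int[P]_w (B w)%:E = \int[P]_w B' w.
  apply: ge0_ae_eq_integral => //; first exact/measurable_EFinP.
    by move=> w _; rewrite lee_fin.
  exists N; split => // w /= wN; apply: contrapT => nN; apply: wN => _.
  by rewrite /B' memNset.
rewrite !ge0_integralTE //.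
apply: le_ereal_sup => _ [h hf <-]; exists h => // w; apply: le_trans (hf w) _.
rewrite /B'; case: ifPn => [_|wN]; first exact: leey.
rewrite funeposE -EFin_max lee_fin ge_max B0 andbT.
by apply: contrapT => nfB; move: wN; rewrite notin_setE; apply; exact: fB.
Qed.

Lemma expectation_le_sum (f : W -> R) (T : nat) (Q : pred nat) (a : nat -> R)
    (b : nat -> W -> R) (beta : nat -> R) :
  (forall t, 0 <= a t)%R -> (forall t w, 0 <= b t w)%R ->
  (forall t, measurable_fun setT (b t)) ->
  (forall t, (0 < t)%N -> Q t -> \int[P]_w (b t w)%:E <= (beta t)%:E) ->
  {ae P, forall w, (f w <= \sum_(1 <= t < T.+1 | Q t) (a t + b t w))%R} ->
  'E_P[f] <= (\sum_(1 <= t < T.+1 | Q t) (a t + beta t))%R%:E.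
Proof.
move=> a0 b0 mb bbeta fb.
have mab t : measurable_fun setT (fun w => a t + b t w)%R.
  exact: measurable_funD.
apply: le_trans (expectation_le_ae _ _ fb) _.
- rewrite (_ : (fun w => _) = fun w =>
    (\sum_(t <- [seq t <- index_iota 1 T.+1 | Q t]) (a t + b t w))%R).
    exact: measurable_sum.
  by apply/funext => w; rewrite big_filter.
- by move=> w; apply: sumr_ge0 => t _; rewrite addr_ge0.
under eq_integral => w _ do rewrite -sumEFin -big_filter.
rewrite ge0_integral_sum //; first last.
- by move=> t w _; rewrite lee_fin addr_ge0.
- by move=> t; exact/measurable_EFinP.
rewrite -sumEFin -[leRHS]big_filter big_seq [leRHS]big_seq; apply: lee_sum => t.
rewrite mem_filter mem_index_iota => /andP[Qt /andP[t0 _]].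
under eq_integral => w _ do rewrite EFinD.
rewrite ge0_integralD //; try (by move=> w _; rewrite lee_fin);
  try (by apply/measurable_EFinP).
rewrite integral_cst //= probability_setT mule1 EFinD leeD2l //.
exact: bbeta.
Qed.

Lemma ae_forall_countable (I : countType) (A : I -> W -> Prop) :
  (forall k, {ae P, forall w, A k w}) -> {ae P, forall w, forall k, A k w}.
Proof.
move=> H; have : {ae P, forall w, forall e : nat,
    if unpickle e is Some k then A k w else True}.
  apply: ae_foralln => e; case: (unpickle e) => [k|]; first exact: H.
  exact: aeW.
by apply: filterS => w Hw k; have := Hw (pickle k); rewrite pickleK.
Qed.

End ExpectationBound.

(** * Sum of the radii and size of the failure terms *)

Section RadiusSum.
Context {R : realType} {n : nat} {Omega S : finType}.
Variables (pb : @problem R n Omega S) (im : implementation pb) (i0 : 'I_n).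
Local Notation K := (phase_length im).

Lemma rate_cube (a b : nat) : rate n #|S| a b ^+ 3 = a%:R * b%:R ^+ 2 :> R.
Proof.
have c (y : R) (u v : R) : 0 <= y -> u * 3 = v -> (y `^ u) ^+ 3 = y `^ v.
  by move=> y0 <-; rewrite powRrM powR_mulrn // powR_ge0.
have e1 : 1 / 3 * 3 = 1 :> R by field.
have e2 : 2 / 3 * 3 = 2%:R :> R by field.
by rewrite /rate exprMn (c _ _ _ _ e1) // (c _ _ _ _ e2) // powRr1 // powR_mulrn.
Qed.

Lemma rate_ge0 a b : 0 <= rate n #|S| a b :> R.
Proof. by rewrite mulr_ge0 ?powR_ge0. Qed.

(** An explore round precedes every exploit round, so the exploit count plus 1 is at most [T]; the
    coefficient 2 of [ln |S|] is raised to 5. *)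
Lemma log_factor_le t T : (0 < t <= T)%N -> ~~ exploring im t ->
  log_factor im t <= 5 * ln (#|S|%:R * T%:R) :> R.
Proof.
move=> /andP[t0 tT] ex; have c0 := card_alloc_gt0 im i0.
have T0 : (0 < T)%N by exact: leq_trans t0 tT.
rewrite /log_factor lnM ?posrE ?ltr0n // mulrDr.
have eT : ln (exploit_count im t).+1%:R <= ln T%:R :> R.
  rewrite ler_ln ?posrE ?ltr0n // ler_nat.
  have := exploit_round_decomp i0 t0 ex; have := phase_length_gt0 im i0.
  have [b0 _ _] := round_state im i0 t0.
  have : (0 < bracket im t * K)%N by rewrite muln_gt0 b0 phase_length_gt0.
  lia.
have S0 : 0 <= ln #|S|%:R :> R by rewrite ln_ge0 // ler1n.
lra.
Qed.

Lemma radius_sum (sigma : R) T : 0 <= sigma -> (2 * K < T)%N ->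
  2 * (\sum_(1 <= t < T.+1 | ~~ exploring im t) radius im sigma t) <=
  10 * sigma * Num.sqrt (ln (#|S|%:R * T%:R)) * rate n #|S| K T.
Proof.
move=> s0 KT; have T0 : (0 < T)%N by lia.
have c0 := card_alloc_gt0 im i0.
set l := ln (#|S|%:R * T%:R).
have l0 : 0 <= l by rewrite ln_ge0 // -natrM ler1n muln_gt0 c0.
have rt : \sum_(1 <= t < T.+1 | ~~ exploring im t) radius im sigma t <=
    sigma * (Num.sqrt 5 * Num.sqrt l) *
    \sum_(1 <= t < T.+1 | ~~ exploring im t) (Num.sqrt (bracket im t)%:R)^-1.
  rewrite mulr_sumr big_seq_cond [leRHS]big_seq_cond; apply: ler_sum => t.
  rewrite mem_index_iota ltnS => /andP[tT ex].
  have L0 : 0 <= log_factor im t by exact: ge0_log_factor.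
  rewrite /radius -mulrA ler_wpM2l // sqrtrM // sqrtrV // ler_wpM2r ?invr_ge0 //.
  by rewrite -sqrtrM // ler_wsqrtr // log_factor_le.
apply: le_trans (ler_wpM2l _ rt) _ => //.
have := sum_inv_sqrt_bracket im i0 T0; set A : R := \sum_(_ <= _ < _ | _) _.
set q := bracket im T => Aq.
(* 161/72 is a rational upper bound of [sqrt 5], close enough that [r^3 * 193/10] stays below
   [216 = 6^3]; after cubing this gives the factor 6 in [Qrate]. *)
have [r [r0 r3 s5]] : exists r : R,
    [/\ 0 <= r, r ^+ 3 * (193 / 10) <= 216 & 0 <= Num.sqrt (5 : R) <= r].
  exists (161 / 72); split; [by lra|by lra|].
  rewrite sqrtr_ge0 /= -[leRHS]ger0_norm; last by lra.
  by rewrite -sqrtr_sqr ler_wsqrtr //; lra.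
have Qrate : r * (q%:R * K%:R) <= 6 * rate n #|S| K T :> R.
  rewrite -(@ler_pXn2r _ 3) // ?nnegrE ?mulr_ge0 ?rate_ge0 //.
  rewrite [leRHS]exprMn rate_cube [leLHS]exprMn [X in _ * X]exprMn.
  have := bracket_cube i0 KT; rewrite -/q.
  have : 0 <= r ^+ 3 by exact: exprn_ge0.
  have : 0 <= K%:R :> R by [].
  move: r3.
  move: (r ^+ 3) => r3; set y := K%:R; set u := q%:R; set v := T%:R => r3le y0 r30 h.
  have {}h : u ^+ 3 * y ^+ 3 <= 193 / 10 * (y * v ^+ 2).
    have -> : u ^+ 3 * y ^+ 3 = y * (u ^+ 3 * y ^+ 2) by ring.
    have -> : 193 / 10 * (y * v ^+ 2) = y * (193 / 10 * v ^+ 2) by ring.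
    exact: ler_wpM2l.
  apply: le_trans (ler_wpM2l r30 h) _; rewrite mulrA.
  apply: (@le_trans _ _ (216 * (y * v ^+ 2))).
    by rewrite ler_wpM2r // mulr_ge0 ?sqr_ge0.
  by rewrite le_eqVlt; apply/orP; left; apply/eqP; congr (_ * _); ring.
have sl : 0 <= sigma * Num.sqrt l by rewrite mulr_ge0 ?sqrtr_ge0.
have K0 : 0 <= K%:R :> R by [].
have q0 : 0 <= q%:R :> R by [].
have A0 : Num.sqrt 5 * A <= 5 * rate n #|S| K T.
  apply: (@le_trans _ _ (r * (5 / 6 * K%:R * q%:R))); last by lra.
  apply: (@le_trans _ _ (Num.sqrt 5 * (5 / 6 * K%:R * q%:R))).
    by rewrite ler_wpM2l //; lra.
  by rewrite ler_wpM2r ?mulr_ge0 //; lra.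
have -> : 2 * (sigma * (Num.sqrt 5 * Num.sqrt l) * A) =
   2 * ((sigma * Num.sqrt l) * (Num.sqrt 5 * A)) by ring.
have -> : 10 * sigma * Num.sqrt l * rate n #|S| K T =
   2 * ((sigma * Num.sqrt l) * (5 * rate n #|S| K T)) by ring.
by do 2 rewrite ler_wpM2l //.
Qed.

(** With [a] the exploit count plus 1, the left side equals [a^(-5/2)]. *)
Lemma expR_log_factor_ETC t :
  #|S|%:R * expR (- (1 ^+ 2 * log_factor im t / 2)) <=
  ((exploit_count im t).+1%:R ^+ 2)^-1 :> R.
Proof.
have c0 := card_alloc_gt0 im i0; have c0' : 0 < #|S|%:R :> R by rewrite ltr0n.
set a := (exploit_count im t).+1%:R.
have a0 : 0 < a by rewrite ltr0n.
have la : 0 <= ln a by rewrite ln_ge0 // ler1n.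
rewrite -(ler_pM2l (x := #|S|%:R^-1)) ?invr_gt0 // mulKf ?gt_eqF //.
have -> : #|S|%:R^-1 * (a ^+ 2)^-1 = expR (- (ln #|S|%:R + 2 * ln a)) :> R.
  by rewrite expRN expRD expRM_natl !lnK ?posrE // [RHS]invfM.
by rewrite ler_expR /log_factor -/a; lra.
Qed.

(** Twice the width turns the exponent into [2 * log_factor], so the exponential is
    [a^(-10) * |S|^(-4)]; the part [a^(-3) * |S|^(-1)] already absorbs the two factors in front. *)
Lemma expR_log_factor_OPT t :
  #|S|%:R * ((exploit_count im t)%:R * expR (- (2 ^+ 2 * log_factor im t / 2))) <=
  ((exploit_count im t).+1%:R ^+ 2)^-1 :> R.
Proof.
have c0 := card_alloc_gt0 im i0; have c0' : 0 < #|S|%:R :> R by rewrite ltr0n.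
set a := (exploit_count im t).+1%:R.
have a0 : 0 < a by rewrite ltr0n.
have la : 0 <= ln a by rewrite ln_ge0 // ler1n.
have lS : 0 <= ln #|S|%:R :> R by rewrite ln_ge0 // ler1n.
apply: (@le_trans _ _ (#|S|%:R * (a * expR (- (ln #|S|%:R + 3 * ln a))))).
  rewrite ler_wpM2l //; apply: ler_pM; rewrite ?expR_ge0 ?ler_nat //.
  by rewrite ler_expR /log_factor -/a; lra.
rewrite expRN expRD expRM_natl !lnK ?posrE //.
rewrite le_eqVlt; apply/orP; left; apply/eqP; field.
by apply/andP; split; rewrite gt_eqF.
Qed.

End RadiusSum.

(** * Bounds on the expected gain *)

Section Gain.
Context {R : realType} {n : nat} {Omega S : finType}.
Variables (pb : @problem R n Omega S) (im : implementation pb) (sigma : R).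
Hypothesis sigma_ge0 : 0 <= sigma.
Context d (W : measurableType d) (P : probability W R).
Variables (X : 'I_n -> nat -> S -> {RV P >-> R}) (xi : 'I_n -> nat -> {RV P >-> R}).
Variables (D : 'I_n -> S -> probability (measurableTypeR R) R).
Hypothesis X_sampled : forall i t s, sampled_from P (X i t s) (D i s).
Hypothesis D_sub_gaussian : forall i s, sub_gaussian sigma (value pb i s) (D i s).
Hypothesis X_xi_independent : independent_family P (primitive X xi).
Variables (i : 'I_n) (pr : pricing).
Implicit Types (pi : @strategy R S) (others : 'I_n -> @strategy R S).

Lemma valid_truthful_version j pi : valid_strategy (truthful_version pb j pi).
Proof.
case: pi => [b|f] /=; first exact: value_range.
move=> t a s; apply: (measurableT_comp (@measurable_snd _ _ _ _)).
by apply: (measurableT_comp (@measurable_fst _ _ _ _)); exact: measurable_snd.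
Qed.

Lemma valid_deviate pi others : valid_strategy pi ->
  (forall j, j != i -> valid_strategy (others j)) ->
  forall j, valid_strategy (deviate i pi others j).
Proof. by move=> vpi vo j; rewrite /deviate; case: eqVneq => [//|]; exact: vo. Qed.

Lemma deviate_self pi others : deviate i pi others i = pi.
Proof. by rewrite /deviate eqxx. Qed.

Lemma deviate_other pi others j : j != i -> deviate i pi others j = others j.
Proof. by rewrite /deviate => /negbTE ->. Qed.

Lemma gain_sum est pi others T w : gain X xi im sigma est pr i pi others T w =
  \sum_(1 <= t < T.+1 | ~~ exploring im t)
   (round_utility im sigma est pr (deviate i pi others) t
      (run X xi im sigma est pr (deviate i pi others) t.-1 w) i -
    round_utility im sigma est pr (deviate i (truthful_version pb i pi) others) t
      (run X xi im sigma est pr (deviate i (truthful_version pb i pi) others) t.-1 w) i).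
Proof.
rewrite /gain /run !total_utility_history -sumrB [RHS]big_mkcond.
apply: eq_bigr => t _; case: (exploring im t); [exact: subrr|exact: erefl].
Qed.

Lemma center_range est (st : 'I_n -> @strategy R S) h j s :
  valid_strategy (st j) -> 0 <= center im est st h j s <= 1.
Proof.
rewrite /center; case: (st j) => [b|f] /= v; first exact: v.
exact: clipped_mean_range.
Qed.

Section ETC.
Variables (pi : @strategy R S) (others : 'I_n -> @strategy R S) (T : nat).
Hypothesis pi_valid : valid_strategy pi.
Hypothesis others_valid : forall j, j != i -> valid_strategy (others j).
Hypothesis same : same_behaviour X xi im sigma ETC pr i pi others T.

Local Notation st := (deviate i pi others).
Local Notation st' := (deviate i (truthful_version pb i pi) others).
Local Notation run := (run X xi im sigma ETC pr).

Lemma explore_reportsE (sg : 'I_n -> @strategy R S) j w :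
  explore_reports im j (run sg T w) =
  [seq rd_report (round_of im sigma ETC pr sg (fun i t s => X i t s w)
     (fun i t => xi i t w) t) j | t <- iota 1 T & exploring im t].
Proof. by rewrite /explore_reports /Defs.run history_map filter_map -map_comp. Qed.

Lemma ETC_round_gain : {ae P, forall w, forall t, (0 < t <= T)%N -> ~~ exploring im t ->
  exists s s',
    round_utility im sigma ETC pr st t (run st t.-1 w) i -
    round_utility im sigma ETC pr st' t (run st' t.-1 w) i <=
    (value pb i s - center im ETC st' (run st' t.-1 w) i s) +
    (center im ETC st' (run st' t.-1 w) i s' - value pb i s')}.
Proof.
move: same; apply: filterS => w sw t /andP[t0 tT] ex.
apply: (@round_gain_ETC _ _ _ _ _ _ _ _ _ _ _ _ _ _
  (fun j => if by_bids (st' j) then 0 else radius im sigma t)).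
- by move=> j s; exact: spread_ETC.
- move=> j s ji; rewrite /center !(deviate_other _ _ ji).
  case: (others j) => // f.
  apply: clipped_mean_ETC => r /andP[r0 rt] exr.
  have := sw j ji; rewrite !explore_reportsE => /eq_in_map; apply.
  by rewrite mem_filter exr mem_iota; lia.
- by move=> j s ji; rewrite !(spread_ETC _ _ _ _ _ j) // !(deviate_other _ _ ji).
Qed.

(** The centre of a truthful bidder is her value, so both estimation errors vanish. *)
Lemma ETC_truthful_by_bids : by_bids pi ->
  {ae P, forall w, gain X xi im sigma ETC pr i pi others T w <= 0}.
Proof.
move=> bb; move: ETC_round_gain; apply: filterS => w gw.
rewrite gain_sum big_seq_cond; apply: sumr_le0 => t.
rewrite mem_index_iota ltnS => /andP[tT ex]; have [s [s' ss']] := gw t tT ex.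
apply: le_trans ss' _; rewrite /center deviate_self.
by case: (pi) bb => // b _ /=; rewrite !subrr addr0.
Qed.

(** On a good round each of the two errors is at most a radius. On a bad one they add up to at most
    2, since centres and values lie in [0, 1], and a tail term of at least 1 pays for it. The
    constant 4 is this 2 times the two tails. *)
Lemma ETC_gain_by_rewards : ~~ by_bids pi ->
  ('E_P[gain X xi im sigma ETC pr i pi others T] <=
     (2 * (\sum_(1 <= t < T.+1 | ~~ exploring im t) radius im sigma t) + 4)%:E)%E.
Proof.
move=> bb; have c0 := card_alloc_gt0 im i.
have vst' := valid_deviate (@valid_truthful_version i pi) others_valid.
pose f (_ : seq (@observation R S)) (_ : S) (u : R * R * R) : R := u.1.2.
have st'i : st' i = Reports f by rewrite deviate_self; case: (pi) bb.
have fg past (s : S) (p x z : R) : f past s (p, x, z) = x by [].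
have samp t s : sampled_from P (fun w => (fun (_ : S) x _ => x) s (X i t s w) (xi i t w)) (D i s).
  exact: X_sampled.
pose tb s t w := tail_bound im sigma X xi ETC pr st' 1 (bracket im t) t i s (value pb i s) w.
have good s := tail_bound_ae (xi := xi) im sigma_ge0 ETC pr vst' st'i fg samp
  (D_sub_gaussian i s) ltr01.
have {}good : {ae P, forall w, forall s t, (0 < t)%N -> ~~ exploring im t ->
    `|center im ETC st' (run st' t.-1 w) i s - value pb i s| <= radius im sigma t \/
    1 <= tb s t w}.
  apply: ae_forall_countable => s; move: (good s); apply: filterS => w gw t t0 ex.
  have := gw t t0 ex; rewrite clip01_id ?value_range // spread_ETC // st'i mul1r.
  by rewrite (sample_count_ETC _ _ _ _ _ i).
apply: le_trans
  (@expectation_le_sum _ _ _ P _ T (fun t => ~~ exploring im t)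
    (fun t => 2 * radius im sigma t) (fun t w => 2 * \sum_s tb s t w)
    (fun t => 4 * ((exploit_count im t).+1%:R ^+ 2)^-1) _ _ _ _ _) _.
- by move=> t; rewrite mulr_ge0 // ge0_radius.
- by move=> t w; rewrite mulr_ge0 // sumr_ge0 // => s _; exact: ge0_tail_bound.
- move=> t; apply: measurable_funM => //; apply: measurable_sum => s.
  exact: measurable_tail_bound.
- move=> t t0 ex; under eq_integral => w _ do rewrite EFinM -sumEFin.
  rewrite ge0_integralZl //; last 2 first.
  + under eq_fun do rewrite sumEFin; apply/measurable_EFinP.
    by apply: measurable_sum => s; exact: measurable_tail_bound.
  + by move=> w _; rewrite sumEFin lee_fin sumr_ge0 // => s _; exact: ge0_tail_bound.
  rewrite ge0_integral_sum //; last 2 first.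
  + by move=> s; apply/measurable_EFinP; exact: measurable_tail_bound.
  + by move=> s w _; rewrite lee_fin; exact: ge0_tail_bound.
  rewrite (_ : 4 * _ = 2 * (2 * ((exploit_count im t).+1%:R ^+ 2)^-1)); last by ring.
  rewrite EFinM; apply: lee_wpmul2l => //.
  apply: (@le_trans _ _ (\sum_(s : S)
     (2 * expR (- (1 ^+ 2 * log_factor im t / 2)))%:E)%E).
    apply: lee_sum => s _; exact: (integral_tail_bound im X_xi_independent _ _ vst' st'i fg samp
      (D_sub_gaussian i s)).
  rewrite sumEFin lee_fin sumr_const -[leLHS]mulr_natl mulrCA ler_wpM2l //.
  exact: (expR_log_factor_ETC im i t).
- move: good ETC_round_gain; apply: filterS2 => w good gw.
  rewrite gain_sum big_seq_cond [leRHS]big_seq_cond; apply: ler_sum => t.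
  rewrite mem_index_iota ltnS => /andP[tT ex]; have /andP[t0 _] := tT.
  have [s [s' ss']] := gw t tT ex; apply: le_trans ss' _.
  have tb0 s0 : 0 <= tb s0 t w by exact: ge0_tail_bound.
  have r0 := ge0_radius im t sigma_ge0.
  have [allgood|] := pselect (forall s0,
    `|center im ETC st' (run st' t.-1 w) i s0 - value pb i s0| <= radius im sigma t).
    have := allgood s; have := allgood s'; rewrite !ler_norml.
    have : 0 <= \sum_s tb s t w by exact: sumr_ge0.
    lra.
  move=> /existsNP[s0 bad]; have [//|tb1] := good s0 t t0 ex.
  have : 1 <= \sum_s tb s t w.
    by rewrite (bigD1 s0) //= -[leLHS]addr0 lerD // sumr_ge0.
  have := value_range pb i s; have := value_range pb i s'.
  have := center_range ETC (run st' t.-1 w) s (vst' i).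
  have := center_range ETC (run st' t.-1 w) s' (vst' i).
  lra.
rewrite lee_fin big_split /= -!mulr_sumr lerD2l.
rewrite -[leRHS]mulr1 ler_wpM2l //; apply: le_trans (sum_inv_exploit_count_sq im T) _.
by rewrite gerBl invr_ge0.
Qed.

End ETC.

End Gain.

(** * Expected gain under OPT *)

Section OptGain.
Context {R : realType} {n : nat} {Omega S : finType}.
Variables (pb : @problem R n Omega S) (im : implementation pb) (sigma : R).
Hypothesis sigma_ge0 : 0 <= sigma.
Context d (W : measurableType d) (P : probability W R).
Variables (X : 'I_n -> nat -> S -> {RV P >-> R}) (xi : 'I_n -> nat -> {RV P >-> R}).
Hypothesis X_xi_independent : independent_family P (primitive X xi).
Variables (pr : pricing).

(* [V] is the limit of the estimates: means of reports may lie outside [0, 1],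
   the averages are clipped *)
Definition estimates (j : 'I_n) (sj : @strategy R S) (V : S -> R) : Prop :=
  match sj with
  | Bids b => V = b
  | Reports f => exists Q g m,
      [/\ forall past s p x z, f past s (p, x, z) = g s x z,
          forall t s, sampled_from P (fun w => g s (X j t s w) (xi j t w)) (Q s),
          forall s, sub_gaussian sigma (m s) (Q s) &
          V = fun s => clip01 (m s)]
  end.

Lemma stationary_estimates j sj :
  stationary X xi sigma j sj -> exists V, estimates j sj V.
Proof.
case: sj => [b _|f /= [Q [g [fg samp sg]]]]; first by exists b.
have [m mP] := choice sg.
by exists (fun s => clip01 (m s)), Q, g, m.
Qed.

(* [B t s] dominates the indicator of a bad estimate for [s] on round [t] *)
Definition opt_bad (j : 'I_n) (st : 'I_n -> @strategy R S) (V B : _) : Prop :=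
  [/\ forall t s w, 0 <= B t s w :> R,
      forall t s, measurable_fun setT (B t s),
      forall t s, (0 < t)%N -> ~~ exploring im t ->
        (\int[P]_w (B t s w)%:E <= (2 * ((exploit_count im t)%:R *
           expR (- (2 ^+ 2 * log_factor im t / 2))))%:E)%E &
      {ae P, forall w, forall s t, (0 < t)%N -> ~~ exploring im t ->
        `|center im OPT st (run X xi im sigma OPT pr st t.-1 w) j s - V s| <=
           2 * spread im sigma OPT st t (run X xi im sigma OPT pr st t.-1 w) j s \/
        1 <= B t s w}].

Lemma opt_bad_exists (st : 'I_n -> @strategy R S) j V :
  (forall j, valid_strategy (st j)) -> estimates j (st j) V ->
  exists B : nat -> S -> W -> R, opt_bad j st V B.
Proof.
move=> vst; case stj : (st j) => [b|f] /=.
  move=> ->; exists (fun _ _ _ => 0); split => //.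
    move=> t s t0 ex; rewrite integral_cst //= mul0e lee_fin.
    by rewrite !mulr_ge0 ?expR_ge0.
  apply: aeW => w s t t0 ex; left.
  by rewrite /center /spread stj subrr normr0 mulr0.
move=> [Q [g [m [fg samp sg ->]]]].
(* All sample counts that can occur on round [t] are included: [exploit_count im t] many, starting
   at the bracket. *)
pose B t s w := \sum_(bracket im t <= k < bracket im t + exploit_count im t)
  tail_bound im sigma X xi OPT pr st 2 k t j s (m s) w.
exists B; split.
- by move=> t s w; apply: sumr_ge0 => k _; exact: ge0_tail_bound.
- by move=> t s; apply: measurable_sum => k; exact: measurable_tail_bound.
- move=> t s t0 ex; under eq_integral => w _ do rewrite -sumEFin.
  rewrite ge0_integral_sum //; last 2 first.
  + by move=> k; apply/measurable_EFinP; exact: measurable_tail_bound.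
  + by move=> k w _; rewrite lee_fin; exact: ge0_tail_bound.
  apply: (@le_trans _ _ (\sum_(bracket im t <= k < bracket im t + exploit_count im t)
     (2 * expR (- (2 ^+ 2 * log_factor im t / 2)))%:E)%E).
    apply: lee_sum => k _.
    exact: (integral_tail_bound im X_xi_independent _ _ vst stj fg samp (sg s)).
  rewrite sumEFin lee_fin sumr_const_nat addKn -[leLHS]mulr_natl.
  by rewrite mulrCA.
- apply: ae_forall_countable => s.
  move: (tail_bound_ae im sigma_ge0 OPT pr vst stj fg samp (sg s) (ltr0n R 2)).
  apply: filterS => w gw t t0 ex; have [good|bad] := gw t t0 ex; [by left|right].
  apply: le_trans bad _; rewrite /B.
  set N := sample_count _ _ _ _ _.
  have Nlo : (bracket im t <= N)%N by exact: (sample_count_ge _ _ _ _ _ _ j).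
  have Nhi : (N < bracket im t + exploit_count im t)%N.
    exact: (sample_count_lt _ _ _ _ _ _ j).
  rewrite (big_cat_nat Nlo (ltnW Nhi)) /= [X in _ + X]big_ltn // addrCA lerDl addr_ge0 //.
    by apply: sumr_ge0 => k _; exact: ge0_tail_bound.
  by apply: sumr_ge0 => k _; exact: ge0_tail_bound.
Qed.

Variables (i : 'I_n) (pi : @strategy R S) (others : 'I_n -> @strategy R S).
Hypothesis pi_valid : valid_strategy pi.
Hypothesis others_valid : forall j, j != i -> valid_strategy (others j).
Hypothesis others_stationary : forall j, j != i -> stationary X xi sigma j (others j).
Variables (D : 'I_n -> S -> probability (measurableTypeR R) R).
Hypothesis X_sampled : forall i t s, sampled_from P (X i t s) (D i s).
Hypothesis D_sub_gaussian : forall i s, sub_gaussian sigma (value pb i s) (D i s).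

Lemma truthful_estimates j sj :
  estimates j (truthful_version pb j sj) (value pb j).
Proof.
case: sj => [b|f] //=; exists (D j), (fun _ x _ => x), (value pb j); split => //.
by apply/funext => s; rewrite clip01_id ?value_range.
Qed.

Lemma truthful_stationary j sj :
  stationary X xi sigma j (truthful_version pb j sj).
Proof.
case: sj => [b|f] //=; exists (D j), (fun _ x _ => x); split => //.
by move=> s; exists (value pb j s); exact: D_sub_gaussian.
Qed.

Local Notation st := (deviate i pi others).
Local Notation st' := (deviate i (truthful_version pb i pi) others).

Lemma OPT_gain T :
  ('E_P[gain X xi im sigma OPT pr i pi others T] <=
     (12 * n%:R * (\sum_(1 <= t < T.+1 | ~~ exploring im t) radius im sigma t)
      + 8 * n%:R)%:E)%E.
Proof.
have vst := valid_deviate pi_valid others_valid.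
have vst' := valid_deviate (@valid_truthful_version _ _ _ _ pb i pi) others_valid.
(* The limits depend only on the strategies of the others, so the same [V] serves both runs. *)
have /choice[V VP] : forall j : 'I_n, exists Vj, j != i -> estimates j (others j) Vj.
  move=> j; have [->|ji] := eqVneq j i; first by exists (fun=> 0).
  by have [Vj ?] := stationary_estimates (others_stationary ji); exists Vj.
pose V' j := if j == i then value pb i else V j.
have /choice[B BP] : forall j : 'I_n, exists Bj, j != i -> opt_bad j st (V j) Bj.
  move=> j; have [->|ji] := eqVneq j i; first by exists (fun _ _ _ => 0).
  have [|Bj ?] := @opt_bad_exists st j (V j) vst; last by exists Bj.
  by rewrite deviate_other //; exact: VP.
have /choice[B' BP'] : forall j : 'I_n, exists Bj, opt_bad j st' (V' j) Bj.
  move=> j; apply: opt_bad_exists; first exact: vst'.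
  rewrite /V'; have [->|ji] := eqVneq j i; last by rewrite deviate_other //; exact: VP.
  by rewrite deviate_self; exact: truthful_estimates.
pose c t : R := (exploit_count im t)%:R * expR (- (2 ^+ 2 * log_factor im t / 2)).
have c0 t : 0 <= c t by rewrite mulr_ge0 ?expR_ge0.
(* Agent [i] is left out on the deviating run: her reports there may be arbitrary, and
   [round_gain_good] asks nothing about them. *)
pose BB j t s w := (if j == i then 0 else B j t s w) + B' j t s w.
have B0 j t s w : 0 <= (if j == i then 0 else B j t s w).
  by case: eqVneq => // ji; have [] := BP j ji.
have B'0 j t s w : 0 <= B' j t s w by have [] := BP' j.
have BB0 j t s w : 0 <= BB j t s w by rewrite addr_ge0.
have mBi j t s : measurable_fun setT (fun w => if j == i then 0 else B j t s w).
  by case: eqVneq => // ji; have [] := BP j ji.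
have mB' j t s : measurable_fun setT (B' j t s) by have [] := BP' j.
have mBB j t s : measurable_fun setT (BB j t s) by exact: measurable_funD.
have iBB j t s : (0 < t)%N -> ~~ exploring im t ->
    (\int[P]_w (BB j t s w)%:E <= (4 * c t)%:E)%E.
  move=> t0 ex; under eq_integral => w _ do rewrite EFinD.
  rewrite ge0_integralD //; try (by move=> w _; rewrite lee_fin);
    try (by apply/measurable_EFinP).
  rewrite (_ : 4 * c t = 2 * c t + 2 * c t); last by ring.
  rewrite EFinD; apply: leeD; last by have [_ _ ib _] := BP' j; exact: ib.
  case: eqVneq => [_|ji]; last by have [_ _ ib _] := BP j ji; exact: ib.
  by rewrite integral_cst //= mul0e lee_fin mulr_ge0.
(* The constant 8 is the 2 lost on a bad round, times two runs, times two tails; the factor [n]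
   counts the agents. *)
apply: le_trans
  (@expectation_le_sum _ _ _ P _ T (fun t => ~~ exploring im t)
    (fun t => 12 * n%:R * radius im sigma t) (fun t w => 2 * \sum_j \sum_s BB j t s w)
    (fun t => 8 * n%:R * ((exploit_count im t).+1%:R ^+ 2)^-1) _ _ _ _ _) _.
- by move=> t; rewrite mulr_ge0 ?mulr_ge0 // ge0_radius.
- by move=> t w; rewrite mulr_ge0 // !sumr_ge0 // => j _; rewrite sumr_ge0.
- move=> t; apply: measurable_funM => //; apply: measurable_sum => j.
  exact: measurable_sum.
- move=> t t0 ex; under eq_integral => w _ do rewrite EFinM pair_big /= -sumEFin.
  rewrite ge0_integralZl //; last 2 first.
  + under eq_fun do rewrite sumEFin; apply/measurable_EFinP.
    exact: measurable_sum.
  + by move=> w _; rewrite sumEFin lee_fin sumr_ge0.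
  rewrite ge0_integral_sum //; last 2 first.
  + by move=> js; apply/measurable_EFinP.
  + by move=> js w _; rewrite lee_fin.
  rewrite (_ : 8 * n%:R * _ = 2 * (4 * n%:R * ((exploit_count im t).+1%:R ^+ 2)^-1));
    last by ring.
  rewrite EFinM; apply: lee_wpmul2l => //.
  apply: (@le_trans _ _ (\sum_(js : 'I_n * S) (4 * c t)%:E)%E).
    by apply: lee_sum => js _; exact: iBB.
  rewrite sumEFin lee_fin sumr_const card_prod card_ord -[leLHS]mulr_natl natrM.
  have := expR_log_factor_OPT im i t; rewrite -/(c t) => h.
  rewrite (_ : _ * (4 * c t) = 4 * n%:R * (#|S|%:R * c t)); last by ring.
  by rewrite ler_wpM2l // mulr_ge0.
- have ae1 : {ae P, forall w, forall j, j != i -> forall s t, (0 < t)%N -> ~~ exploring im t ->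
      `|center im OPT st (run X xi im sigma OPT pr st t.-1 w) j s - V j s| <=
         2 * spread im sigma OPT st t (run X xi im sigma OPT pr st t.-1 w) j s \/
      1 <= B j t s w}.
    apply: ae_forall_countable => j; have [_|ji] := eqVneq j i; first exact: aeW.
    by have [_ _ _] := BP j ji; apply: filterS => w.
  have ae2 : {ae P, forall w, forall j s t, (0 < t)%N -> ~~ exploring im t ->
      `|center im OPT st' (run X xi im sigma OPT pr st' t.-1 w) j s - V' j s| <=
         2 * spread im sigma OPT st' t (run X xi im sigma OPT pr st' t.-1 w) j s \/
      1 <= B' j t s w}.
    by apply: ae_forall_countable => j; have [] := BP' j.
  move: ae1 ae2; apply: filterS2 => w g g'.
  rewrite gain_sum big_seq_cond [leRHS]big_seq_cond; apply: ler_sum => t.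
  rewrite mem_index_iota => /andP[/andP[t0 _] ex].
  have r0 := ge0_radius im t sigma_ge0.
  have sp j s := spread_range sigma_ge0 OPT pr st (fun i t s => X i t s w)
    (fun i t => xi i t w) i j s t0 ex.
  have sp' j s := spread_range sigma_ge0 OPT pr st' (fun i t s => X i t s w)
    (fun i t => xi i t w) i j s t0 ex.
  set A := \sum_j _; have A0 : 0 <= A by rewrite !sumr_ge0 // => j _; rewrite sumr_ge0.
  have n1 : 1 <= n%:R :> R by rewrite ler1n; exact: leq_ltn_trans (leq0n i) (ltn_ord i).
  have BBA j s : BB j t s w <= A.
    rewrite /A (bigD1 j) //= (bigD1 s) //= -addrA lerDl addr_ge0 // sumr_ge0 // => k _.
    by rewrite sumr_ge0.
  (* If [A >= 1], then [2 * A] pays for the constant 2 of the unconditional bound, and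
     [4 * n + 1 <= 12 * n]. Otherwise no estimate is bad on this round. *)
  have [A1|A1] := lerP 1 A.
    apply: le_trans (round_gain_unconditional pr sp sp' _) _.
      by move=> s; exact: center_range.
    have : n%:R * radius im sigma t >= radius im sigma t.
      by rewrite -[leLHS]mul1r ler_wpM2r.
    lra.
  have nB j s : ~ (1 <= BB j t s w).
    by move=> h; have := le_lt_trans (le_trans h (BBA j s)) A1; rewrite ltxx.
  have good' j s :
      `|center im OPT st' (run X xi im sigma OPT pr st' t.-1 w) j s - V' j s| <=
         2 * spread im sigma OPT st' t (run X xi im sigma OPT pr st' t.-1 w) j s.
    have [//|h] := g' j s t t0 ex; case: (nB j s); rewrite /BB.
    by apply: le_trans h _; rewrite lerDr.
  have good j s : j != i ->
      `|center im OPT st (run X xi im sigma OPT pr st t.-1 w) j s - V j s| <=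
         2 * spread im sigma OPT st t (run X xi im sigma OPT pr st t.-1 w) j s.
    move=> ji; have [//|h] := g j ji s t t0 ex; case: (nB j s); rewrite /BB (negbTE ji).
    by apply: le_trans h _; rewrite lerDl.
  apply: le_trans (round_gain_good pr sp sp' good _ _) _.
  + by move=> j s ji; have := good' j s; rewrite /V' (negbTE ji).
  + by move=> s; have := good' i s; rewrite /V' eqxx.
  + by rewrite lerDl mulr_ge0.
rewrite lee_fin big_split /= -!mulr_sumr lerD2l.
rewrite -[leRHS]mulr1 ler_wpM2l ?mulr_ge0 //.
apply: le_trans (sum_inv_exploit_count_sq im T) _.
by rewrite gerBl invr_ge0.
Qed.

End OptGain.

(** * Asymptotics *)

Section Asymptotics.
Context {R : realType}.

Lemma rate_ge1 n s K T : (0 < K)%N -> (0 < T)%N -> 1 <= rate n s K T :> R.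
Proof.
have p1 (a : nat) (r : R) : (0 < a)%N -> 0 <= r -> 1 <= a%:R `^ r.
  by move=> a0 r0; rewrite -[leLHS](powRr0 a%:R) ler_powR // ler1n.
by move=> K0 T0; rewrite /rate -[leLHS]mulr1; apply: ler_pM => //; apply: p1 => //; lra.
Qed.

(** From [ln m >= 1 - 1/m] with [m >= 3]. It keeps the logarithm away from 0, so that square roots
    and additive constants can be absorbed in it. *)
Lemma log_ge_half (s T : nat) : (0 < s)%N -> (2 < T)%N -> 1 / 2 <= ln (s%:R * T%:R) :> R.
Proof.
move=> s0 T2; rewrite -natrM; have : (3 <= s * T)%N by nia.
move: (s * T)%N => m m3; have m0 : 3 <= m%:R :> R by rewrite ler_nat.
have : ln (m%:R)^-1 <= m%:R^-1 - 1 :> R.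
  have -> : m%:R^-1 = 1 + (m%:R^-1 - 1) :> R by ring.
  rewrite addrAC subrr add0r; apply: le_ln1Dx.
  have : 0 < m%:R^-1 :> R by rewrite invr_gt0; lra.
  lra.
rewrite lnV ?posrE; last by lra.
have : m%:R^-1 <= 1 / 2 :> R.
  by rewrite div1r lef_pV2 ?posrE; lra.
lra.
Qed.

Lemma sqrt_le_double (l : R) : 1 / 2 <= l -> Num.sqrt l <= 2 * l.
Proof.
move=> l2; have s2 : Num.sqrt l ^+ 2 = l by rewrite sqr_sqrtr //; lra.
have s0 := sqrtr_ge0 l; nra.
Qed.

Lemma soft_O_bound (C c : R) (A B : nat -> R) : 0 <= C -> 0 <= c ->
  (forall n, (0 < n)%N -> 0 <= A n <= C * B n) ->
  (forall n, (0 < n)%N -> 1 <= B n) -> forall e : nat -> R,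
  (forall n, (0 < n)%N -> e n <= c * B n) ->
  soft_O (fun n s K T => A n * Num.sqrt (ln (s%:R * T%:R)) * rate n s K T + e n)
    (fun n s K T => B n * rate n s K T).
Proof.
move=> C0 c0 AB B1 e ec; exists (2 * C + 2 * c), 1%N => n s K T n0 s0 K0 KT.
rewrite expr1; have T2 : (2 < T)%N by lia.
have T0 : (0 < T)%N by lia.
have := rate_ge1 n s K0 T0; have := log_ge_half s0 T2.
set l := ln _; set r := rate _ _ _ _ => l2 r1.
have sl := sqrt_le_double l2; have sl0 := sqrtr_ge0 l.
have /andP[A0 ABn] := AB n n0; have Bn := B1 n n0; have en := ec n n0.
have r0 : 0 <= r by lra.
have h1 : A n * Num.sqrt l * r <= C * B n * (2 * l) * r.
  by rewrite ler_wpM2r // ler_pM.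
have h2 : e n <= c * B n * (2 * l) * r.
  have l1 : 1 <= 2 * l by lra.
  have cB : 0 <= c * B n by rewrite mulr_ge0 //; lra.
  apply: le_trans en _; rewrite -mulrA -[leLHS]mulr1 ler_wpM2l //.
  by rewrite -[leLHS]mulr1 ler_pM.
apply: le_trans (lerD h1 h2) _; rewrite le_eqVlt; apply/orP; left; apply/eqP.
by ring.
Qed.

(** The rate bound starts only after [2 * K]; [u] provides finite values before that. Afterwards
    [ln T <= 6 * T^(1/6)] makes the root of the logarithm [O(T^(1/12))], and
    [1/12 + 2/3 = 3/4 < 1]. *)
Lemma sublinear_rate (a : nat -> \bar R) (u : nat -> R) (C c : R) (n s K : nat) :
  0 <= C -> 0 <= c -> (0 < s)%N -> (forall T, (a T <= (u T)%:E)%E) ->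
  (forall T, (2 * K < T)%N ->
    (a T <= (C * Num.sqrt (ln (s%:R * T%:R)) * rate n s K T + c)%:E)%E) ->
  sublinear a.
Proof.
move=> C0 c0 s0 au ab.
pose f T : R := if (2 * K < T)%N
  then C * Num.sqrt (ln (s%:R * T%:R)) * rate n s K T + c else u T.
exists f; last by move=> T; rewrite /f; case: ifP => [/ab|_ //].
pose M := C * (Num.sqrt (ln s%:R + 6) * K%:R `^ (1 / 3)) + c.
have ls : 0 <= ln s%:R :> R by rewrite ln_ge0 // ler1n.
have M0 : 0 <= M by rewrite addr_ge0 // mulr_ge0 // mulr_ge0 ?sqrtr_ge0 ?powR_ge0.
have fM T : (2 * K < T)%N -> 0 <= f T <= M * T%:R `^ (3 / 4).
  move=> KT; rewrite /f KT; have T0 : (0 < T)%N by lia.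
  have T1 : 1 <= T%:R :> R by rewrite ler1n.
  have Tp : 0 < T%:R :> R by lra.
  have r0 : 0 <= rate n s K T :> R by rewrite mulr_ge0 ?powR_ge0.
  rewrite addr_ge0 ?mulr_ge0 ?sqrtr_ge0 //=.
  have p1 (r : R) : 0 <= r -> 1 <= T%:R `^ r.
    by move=> r0'; rewrite -[leLHS](powRr0 T%:R) ler_powR.
  have lnT : ln (s%:R * T%:R) <= (ln s%:R + 6) * T%:R `^ (1 / 6) :> R.
    rewrite lnM ?posrE ?ltr0n // mulrDl; apply: lerD.
      by rewrite -[leLHS]mulr1 ler_wpM2l // p1 //; lra.
    have -> : ln T%:R = 6 * ln (T%:R `^ (1 / 6)) :> R by rewrite ln_powR; field.
    by rewrite ler_wpM2l // ltW // ln_sublinear // powR_gt0.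
  have sq : Num.sqrt (T%:R `^ (1 / 6)) = T%:R `^ (1 / 12) :> R.
    by rewrite -powR12_sqrt ?powR_ge0 // -powRrM; congr powR; field.
  have sT : Num.sqrt (ln (s%:R * T%:R)) <=
      Num.sqrt (ln s%:R + 6) * T%:R `^ (1 / 12) :> R.
    rewrite -sq -sqrtrM; last by lra.
    exact: ler_wsqrtr.
  rewrite mulrDl; apply: lerD; last first.
    by rewrite -[leLHS]mulr1 ler_wpM2l // p1 //; lra.
  have -> : T%:R `^ (3 / 4) = T%:R `^ (1 / 12) * T%:R `^ (2 / 3) :> R.
    rewrite -powRD; first by congr powR; field.
    by apply/implyP => _; rewrite gt_eqF.
  rewrite /rate.
  rewrite (_ : C * (_ * _) * (_ * _) = C * (Num.sqrt (ln s%:R + 6) * T%:R `^ (1 / 12))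
     * (K%:R `^ (1 / 3) * T%:R `^ (2 / 3))); last by ring.
  by rewrite ler_wpM2r ?mulr_ge0 ?powR_ge0 // ler_wpM2l.
apply/eqoP => e e0.
(* From [T >= (M / e)^4] on, [M * T^(3/4) <= e * T]. *)
exists ((2 * K).+1 + (Num.truncn ((M / e) ^+ 4)).+1)%N => // T /= NT.
have KT : (2 * K < T)%N by lia.
have /andP[f0 fT] := fM T KT; rewrite ger0_norm // ger0_norm //.
apply: le_trans fT _.
have Tp : 0 < T%:R :> R by rewrite ltr0n; lia.
have big : M / e <= T%:R `^ (1 / 4).
  have y0 : 0 <= M / e by rewrite divr_ge0 // ltW.
  rewrite -(@ler_pXn2r _ 4) ?nnegrE ?powR_ge0 // -[leRHS]powR_mulrn ?powR_ge0 //.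
  rewrite -powRrM (_ : 1 / 4 * 4 = 1); last by field.
  rewrite powRr1 ?(ltW Tp) //; apply: ltW.
  by apply: lt_le_trans (truncnS_gt _) _; rewrite ler_nat (leq_trans _ NT) // leq_addl.
have -> : e * T%:R = e * T%:R `^ (1 / 4) * T%:R `^ (3 / 4).
  rewrite -mulrA -powRD; first by rewrite (_ : 1 / 4 + 3 / 4 = 1) ?powRr1 //; field.
  by apply/implyP => _; rewrite gt_eqF.
by rewrite ler_wpM2r ?powR_ge0 // mulrC -ler_pdivrMr.
Qed.

End Asymptotics.

Theorem theorem2 (R : realType) (n : nat) (Omega S : finType)
    (pb : @problem R n Omega S) (im : implementation pb) (sigma : R)
    (sigma_ge0 : 0 <= sigma)
    (d : measure_display) (W : measurableType d) (P : probability W R)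
    (X : 'I_n -> nat -> S -> {RV P >-> R}) (xi : 'I_n -> nat -> {RV P >-> R})
    (D : 'I_n -> S -> probability (measurableTypeR R) R)
    (X_sampled : forall i t s, sampled_from P (X i t s) (D i s))
    (D_sub_gaussian : forall i s, sub_gaussian sigma (value pb i s) (D i s))
    (X_xi_independent : independent_family P (primitive X xi))
    (i : 'I_n) (pr : pricing) :
  [/\ (* 1. ETC *)
      forall (pi : strategy) (others : 'I_n -> strategy),
        valid_strategy pi ->
        (forall j, j != i -> valid_strategy (others j)) ->
        [/\ by_bids pi -> forall T : nat,
              same_behaviour X xi im sigma ETC pr i pi others T ->
              {ae P, forall w, gain X xi im sigma ETC pr i pi others T w <= 0} &
            ~~ by_bids pi -> forall T : nat, (2 * phase_length im < T)%N ->
              same_behaviour X xi im sigma ETC pr i pi others T ->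
              ('E_P[gain X xi im sigma ETC pr i pi others T]
                 <= (bound_ETC sigma n #|S| (phase_length im) T)%:E)%E],
      soft_O (bound_ETC sigma) rate,
      (* 2. OPT *)
      forall (pi : strategy) (others : 'I_n -> strategy),
        valid_strategy pi ->
        (forall j, j != i -> valid_strategy (others j)) ->
        (forall j, j != i -> stationary X xi sigma j (others j)) ->
        forall T : nat, (2 * phase_length im < T)%N ->
          ('E_P[gain X xi im sigma OPT pr i pi others T]
             <= (bound_OPT sigma n #|S| (phase_length im) T)%:E)%E,
      soft_O (bound_OPT sigma) (fun n s K T => n%:R * rate n s K T) &
      asymptotically_truthful_by_rewards X xi im sigma ETC pr i /\
      asymptotically_NIC_by_rewards X xi im sigma OPT pr i].
Proof.
have S0 := card_alloc_gt0 im i.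
have etc pi others (T : nat) : (forall j, j != i -> valid_strategy (others j)) ->
    ~~ by_bids pi -> (2 * phase_length im < T)%N ->
    same_behaviour X xi im sigma ETC pr i pi others T ->
    ('E_P[gain X xi im sigma ETC pr i pi others T]
       <= (bound_ETC sigma n #|S| (phase_length im) T)%:E)%E.
  move=> vo bb KT same.
  apply: le_trans (ETC_gain_by_rewards sigma_ge0 X_sampled D_sub_gaussian
    X_xi_independent vo same bb) _.
  by rewrite lee_fin lerD2r; exact: radius_sum.
have opt pi others (T : nat) : valid_strategy pi ->
    (forall j, j != i -> valid_strategy (others j)) ->
    (forall j, j != i -> stationary X xi sigma j (others j)) ->
    (2 * phase_length im < T)%N ->
    ('E_P[gain X xi im sigma OPT pr i pi others T]
       <= (bound_OPT sigma n #|S| (phase_length im) T)%:E)%E.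
  move=> vpi vo so KT.
  apply: le_trans (OPT_gain im sigma_ge0 X_xi_independent pr vpi vo so X_sampled
    D_sub_gaussian T) _.
  (* [12 * n * r] is read as [6 * n * (2 * r)]; the summand 2 in [6 * n + 2] and the step from
     [8 * n] to [12 * n] are slack. *)
  have := radius_sum i sigma_ge0 KT; rewrite lee_fin /bound_OPT.
  set r := \sum_(_ <= _ < _ | _) _; set l := Num.sqrt _; set q := rate _ _ _ _ => h.
  have n0 : 0 <= n%:R :> R by [].
  have : 6 * n%:R * (2 * r) <= 6 * n%:R * (10 * sigma * l * q).
    by rewrite ler_wpM2l ?mulr_ge0.
  have : 0 <= 10 * sigma * l * q by rewrite !mulr_ge0 ?sqrtr_ge0 ?rate_ge0.
  move: h; set y := 10 * sigma * l * q => h y0 h6.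
  have -> : 10 * sigma * (6 * n%:R + 2) * l * q = (6 * n%:R + 2) * y by rewrite /y; ring.
  lra.
have sC : 0 <= 10 * sigma by exact: mulr_ge0.
have bETC : bound_ETC sigma =
    fun n s K T => 10 * sigma * Num.sqrt (ln (s%:R * T%:R)) * rate n s K T + 4.
  by [].
have bOPT : bound_OPT sigma = fun n s K T => 10 * sigma * (6 * n%:R + 2) *
    Num.sqrt (ln (s%:R * T%:R)) * rate n s K T + 12 * n%:R.
  by [].
split.
- move=> pi others vpi vo; split => [bb T same|bb T KT same].
    exact: (ETC_truthful_by_bids sigma_ge0 same bb).
  exact: etc.
- have [c [p h]] : soft_O (bound_ETC sigma) (fun n s K T => 1 * rate n s K T).
    apply: (@soft_O_bound R (10 * sigma) 4 (fun=> 10 * sigma) (fun=> 1) _ _ _ _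
      (fun=> 4)) => // m _; last by rewrite mulr1.
    by rewrite mulr1 lexx andbT.
  by exists c, p => m s K T m0 s0 K0 KT; have := h m s K T m0 s0 K0 KT; rewrite mul1r.
- by move=> pi others vpi vo so T KT; exact: opt.
(* 80 comes from [10 * (6 * n + 2) <= 80 * n] for [n >= 1]. *)
- apply: (@soft_O_bound R (80 * sigma) 12 (fun n => 10 * sigma * (6 * n%:R + 2))
    (fun n => n%:R) _ _ _ _ (fun n => 12 * n%:R)).
  + exact: mulr_ge0.
  + by [].
  + move=> m m0; have m1 : 1 <= m%:R :> R by rewrite ler1n.
    rewrite mulr_ge0 ?addr_ge0 ?mulr_ge0 //=.
    have : 0 <= sigma * (m%:R - 1) by rewrite mulr_ge0 //; lra.
    lra.
  + by move=> m m0; rewrite ler1n.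
  + by [].
- split.
    move=> pi others vpi bb vo same.
    apply: (@sublinear_rate _ _ _ (10 * sigma) 4 n #|S| (phase_length im)) => //.
      move=> T; exact: (ETC_gain_by_rewards sigma_ge0 X_sampled D_sub_gaussian
        X_xi_independent vo (same T) bb).
    by move=> T KT; exact: etc.
  move=> pi others vpi bb ot.
  have vo j : j != i -> valid_strategy (others j).
    by move=> /ot ->; exact: valid_truthful_version.
  have so j : j != i -> stationary X xi sigma j (others j).
    by move=> /ot ->; exact: (truthful_stationary xi X_sampled D_sub_gaussian).
  apply: (@sublinear_rate _ _ _ (10 * sigma * (6 * n%:R + 2)) (12 * n%:R) n #|S|
    (phase_length im)) => //.
  + by rewrite mulr_ge0 ?addr_ge0 ?mulr_ge0.
  + move=> T; exact: (OPT_gain im sigma_ge0 X_xi_independent pr vpi vo so X_sampled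
      D_sub_gaussian T).
  + by move=> T KT; exact: opt.
Qed.
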